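(* Let $p>q>0$ and $$\mathcal R_{p,q}(\delta)=p^{1+\delta}+q^{1+\delta}-1-(1+\delta)(p+q-1).$$ Let $\delta>0$ be such that $\mathcal R_{p,q}(\delta)<0$, and let $g_\infty(v)$ be the unique stationary solution to the scaled wealth Boltzmann equation (SW) (see context). Let $g(v,t)$ be the weak solution of (SW) corresponding to the initial density $f_0$ on $\mathbb R_+$, with $\int_{\mathbb R_+} f_0(v)\,dv=1$ and $\int_{\mathbb R_+} vf_0(v)\,dv=1$, satisfying $$\int_{\mathbb R_+}|v|^{1+\delta}f_0(v)\,dv<\infty .$$ Then $g(v,t)$ satisfies $$\int_{\mathbb R_+}|v|^{1+\delta}g(v,t)\,dv\le c_\delta<\infty$$ for some constant $c_\delta$ depending only on $p$ and $q$. Moreover, $g(v,t)$ converges exponentially fast in Fourier metric towards $g_\infty(v)$, and the following bound holds: $$d_{1+\delta}(g(t),g_\infty)\le d_{1+\delta}(f_0,g_\infty)\,\exp\{-|\mathcal R_{p,q}(\delta)|\,t\}.$$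
   Context: Probability measures on $\mathbb R_+=[0,\infty)$ are written as densities, extended by $0$ to $\mathbb R$. $\mathcal M_\alpha(\mathbb R_+)$ is the set of Borel probability measures on $\mathbb R_+$ with finite moment of order $\alpha$, with the topology of weak convergence. A weak solution $f$ of the (unscaled) wealth Boltzmann equation with initial datum $f_0\in\mathcal M_\alpha(\mathbb R_+)$, $\alpha>1$, is a probability density $f$, of class $C^1$ in time with values in $\mathcal M_\alpha(\mathbb R_+)$, such that for all $t>0$ and all smooth functions $\phi$ $$\frac d{dt}\int_{\mathbb R_+}\phi(v)f(v,t)\,dv=\int_{\mathbb R_+^2}f(v,t)f(w,t)\big(\phi(pv+qw)-\phi(v)\big)\,dv\,dw,$$ and $\lim_{t\to0}\int\phi(v) f(v,t)\,dv=\int\phi(v) f_0(v)\,dv$ for all such $\phi$. When $f_0$ has mean $1$, $m(t)=\int vf(v,t)\,dv=\exp\{(p+q-1)t\}$. The weak solution of the scaled equation (SW) with initial value $f_0$ is $g(v,t)=m(t)f(m(t)v,t)$. The weak form of (SW) (for $\phi$ vanishing at infinity) is $$\frac d{dt}\int_{\mathbb R_+}\phi(v) g(v,t)\,dv+(p+q-1)\int_{\mathbb R_+}\phi'(v)\,v\,g(v,t)\,dv=\int_{\mathbb R_+^2}g(v,t)g(w,t)\big(\phi(pv+qw)-\phi(v)\big)\,dv\,dw .$$ A stationary solution is a time-independent solution $g_\infty$ of (SW); solutions of (SW), including $g_\infty$, are normalized to unit mass and unit mean. $\widehat f(\xi)=\int_{\mathbb R}e^{-i\xi v}f(v)\,dv$;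 for $s>0$, $d_s(f,g)=\sup_{\xi\ne0}\frac{|\widehat f(\xi)-\widehat g(\xi)|}{|\xi|^s}\in[0,+\infty]$; convergence in Fourier metric means convergence in $d_{1+\delta}$.
   Formalization: The moment bound reads max(c_δ, ∫v^{1+δ}f_0), since no constant independent of f_0 can hold as t→0; and for δ>1 exponential convergence is asserted only when d_{1+δ}(f_0,g_∞)<∞, since otherwise the distance stays infinite (e.g. p+q=1, g_∞=δ_1). *)

(* Defs.v *)
From HB Require Import structures.
From mathcomp Require Import all_boot all_order all_algebra.
From mathcomp Require Import complex.
From mathcomp Require Import all_classical all_reals all_analysis.

Set Implicit Arguments.
Unset Strict Implicit.
Unset Printing Implicit Defensive.

Import Order.TTheory GRing.Theory Num.Theory.
Import numFieldNormedType.Exports.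

Local Open Scope classical_set_scope.
Local Open Scope ring_scope.

(* Borel probability measures on the real line; those on [0, +oo[ are the ones
   giving mass 0 to the complement of halfline (see in_M).  A formula written
   for a density, such as  int phi(v) f(v) dv,  becomes the integral of phi
   against the measure. *)
Notation proba R := (probability (measurableTypeR R) R).

Section wealth_Boltzmann.
Context {R : realType}.
Implicit Types (p q s t xi alpha delta : R) (phi : R -> R) (mu nu : proba R).

Definition halfline : set R := `[0, +oo[%classic.

Definition moment s mu : \bar R :=
  (\int[mu]_(v in halfline) (`|v| `^ s)%:E)%E.

Definition mean mu : R := \int[mu]_(v in halfline) v.

Definition in_M alpha mu : Prop :=
  mu (~` halfline) = 0%E /\ (moment alpha mu < +oo)%E.

(* Smooth functions with bounded derivatives (of every order, including 0) on
   the half-line, so that all the integrals in the weak formulations converge.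
   No growth condition is imposed on the negative axis. *)
Definition test_fun phi : Prop :=
  (forall n v, derivable (derive1n n phi) v 1) /\
  (forall n, exists C : R, forall v, 0 <= v -> `|derive1n n phi v| <= C).

Definition test_fun0 phi : Prop :=
  test_fun phi /\ phi v @[v --> +oo] --> 0.

Definition collision p q phi mu : R :=
  \int[(mu \x mu)%E]_(z in halfline `*` halfline)
     (phi (p * z.1 + q * z.2) - phi z.1).

(* The second clause states the C^1 regularity in time and the equation, both
   for the topology of weak convergence, i.e. after pairing with phi. *)
Definition weak_solution p q alpha mu (f : R -> proba R) : Prop :=
  [/\ in_M alpha mu,
      forall t, 0 < t -> in_M alpha (f t) &
      forall phi, test_fun phi ->
        let F t := \int[f t]_(v in halfline) phi v in
        [/\ forall t, 0 < t -> is_derive t 1 F (collision p q phi (f t)),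
            forall t, 0 < t -> {for t, continuous (derive1 F)} &
            F t @[t --> 0^'+] --> \int[mu]_(v in halfline) phi v] ].

(* The density m f(m v) is that of the image of f(v) dv under v |-> v / m. *)
Definition scaled_solution p q alpha mu (g : R -> proba R) : Prop :=
  exists2 f : R -> proba R, weak_solution p q alpha mu f &
    forall t, 0 < t -> forall A : set (measurableTypeR R), measurable A ->
      g t A = pushforward (f t) (fun v : measurableTypeR R =>
                (v / mean (f t) : measurableTypeR R)) A.

(* Unit mass is built into the type proba R. *)
Definition stationary_solution p q alpha mu : Prop :=
  [/\ in_M alpha mu, mean mu = 1 &
      forall phi, test_fun0 phi ->
        (p + q - 1) * (\int[mu]_(v in halfline) (derive1 phi v * v)) =
        collision p q phi mu].

Definition fourier mu xi : R[i] :=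
  Complex (\int[mu]_v cos (xi * v)) (- \int[mu]_v sin (xi * v)).

Definition fourier_dist s mu nu : \bar R :=
  ereal_sup [set (Normc.normc (fourier mu xi - fourier nu xi) /
                  `|xi| `^ s)%:E | xi in [set xi : R | xi != 0]].

Definition exp_convergence s (g : R -> proba R) nu : Prop :=
  exists C lambda : R, 0 < lambda /\
    forall t, 0 < t ->
      (fourier_dist s (g t) nu <= (C * expR (- (lambda * t)))%:E)%E.

Definition calR p q delta : R :=
  p `^ (1 + delta) + q `^ (1 + delta) - 1 - (1 + delta) * (p + q - 1).

End wealth_Boltzmann.

(* Main.v *)
Require Import Defs.
From mathcomp Require Import all_boot all_order all_algebra.
From mathcomp Require Import all_classical all_reals all_analysis.
From mathcomp Require Import measurable_realfun.
From mathcomp Require Import complex ring lra.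

(** Write s = 1 + delta, kappa = p + q - 1 and m(t) = exp (kappa t).  Test
    functions behave well under the collision operator when they form a family
    phi_i closed under v |-> p v and v |-> q v: the gain term of phi_i is then
    controlled by the integrals of phi_(p i) and phi_(q i), and all of these
    integrals are bounded a priori, so that comparison with a supersolution is
    a contraction argument, uniform in i, which needs no a priori moment bound
    on f(t).

    For phi_xi(v) = a cos (xi v) + b sin (xi v), the rescaled steady state
    ginf^(m(t) xi) solves the same equation as f^(xi, t), and the comparison
    gives |f^(xi, t) - ginf^(m(t) xi)| <= D |xi|^r exp ((p^r + q^r - 1) t)
    whenever this holds at t = 0; for r = s this is the decay of d_s.  For
    r = min(alpha, 2) the bound holds at t = 0 since both means are 1, and
    letting xi -> 0 gives mean (f t) = m(t).

    For phi_eps(v) = (eps v)^s exp (- eps v), which is multiplicative in its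
    exponential factor, the cross terms of (p v + q w)^s are absorbed by the
    dissipation, whence int phi_eps df(t) <= Z (eps m(t))^s; letting eps -> 0
    bounds the moment of order s.

    Finally, for delta <= 1, d_s (f0, ginf) is finite even if ginf is not known
    to have a moment of order s: |f0^ - g(t)^| <= C |xi|^s uniformly in t by the
    moment bound, and g(t)^ -> ginf^ pointwise by the decay in d_r with
    r = min(alpha, s). *)

Import Order.TTheory GRing.Theory Num.Theory.
Import numFieldNormedType.Exports.
Local Open Scope classical_set_scope.
Local Open Scope ring_scope.
Set Implicit Arguments.
Unset Strict Implicit.
Unset Printing Implicit Defensive.

(** * Test functions *)

Section smooth_bounded.
Context {R : realType}.
Implicit Types (f g df F : R -> R) (n : nat).

Definition bounded_halfline f := exists C, forall v, 0 <= v -> `|f v| <= C.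

(** A finite-order form of [test_fun]: recursion on the order lets closure under sums, products and
    exponentials be proved by induction. Derivability is required on the whole line, bounds only on
    the half-line. *)
Fixpoint smoothb n f : Prop :=
  bounded_halfline f /\
  (if n is n'.+1 then (forall v : R, derivable f v 1) /\ smoothb n' (derive1 f)
   else True).

Lemma smoothb_bounded n f : smoothb n f -> bounded_halfline f.
Proof. by case: n => [|n] []. Qed.

Lemma smoothbW n f : smoothb n.+1 f -> smoothb n f.
Proof.
elim: n f => [f [fb _]|n IHn f [fb [df sf']]]; first by split.
by split => //; split => //; exact: IHn.
Qed.

Lemma smoothbS n f df : bounded_halfline f ->
  (forall v : R, is_derive v 1 f (df v)) -> smoothb n df -> smoothb n.+1 f.
Proof.
move=> fb fdf sdf; split=> //; split=> [v|].
  exact: (@ex_derive _ _ _ _ _ _ _ (fdf v)).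
suff -> : derive1 f = df by [].
apply/funext => v; rewrite derive1E.
exact: (@derive_val _ _ _ _ _ _ _ (fdf v)).
Qed.

Lemma smoothb_deriv n f (v : R) : smoothb n.+1 f -> is_derive v 1 f (derive1 f v).
Proof. by move=> [_ [df _]]; rewrite derive1E; exact/derivableP. Qed.

Lemma bounded_halflineD f g : bounded_halfline f -> bounded_halfline g ->
  bounded_halfline (fun v => f v + g v).
Proof.
move=> [C fC] [D gD]; exists (C + D) => v v0.
by rewrite (le_trans (ler_normD _ _))// lerD ?fC ?gD.
Qed.

Lemma bounded_halflineM f g : bounded_halfline f -> bounded_halfline g ->
  bounded_halfline (fun v => f v * g v).
Proof.
move=> [C fC] [D gD]; exists (C * D) => v v0.
by rewrite normrM ler_pM ?fC ?gD.
Qed.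

Lemma smoothbD n f g : smoothb n f -> smoothb n g ->
  smoothb n (fun v => f v + g v).
Proof.
elim: n f g => [f g [fb _] [gb _]|n IHn f g sf sg].
  by split => //; exact: bounded_halflineD.
apply: (@smoothbS _ _ (fun v => derive1 f v + derive1 g v)).
- exact: bounded_halflineD (smoothb_bounded sf) (smoothb_bounded sg).
- by move=> v; exact: is_deriveD (smoothb_deriv v sf) (smoothb_deriv v sg).
- by apply: IHn; [case: sf => _ [_ ?]|case: sg => _ [_ ?]].
Qed.

Lemma smoothbM n f g : smoothb n f -> smoothb n g ->
  smoothb n (fun v => f v * g v).
Proof.
elim: n f g => [f g [fb _] [gb _]|n IHn f g sf sg].
  by split => //; exact: bounded_halflineM.
apply: (@smoothbS _ _ (fun v => f v * derive1 g v + g v * derive1 f v)).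
- exact: bounded_halflineM (smoothb_bounded sf) (smoothb_bounded sg).
- by move=> v; exact: is_deriveM (smoothb_deriv v sf) (smoothb_deriv v sg).
- case: (sf) (sg) => _ [_ sf'] [_ [_ sg']].
  by apply: smoothbD; apply: IHn => //; exact: smoothbW.
Qed.

Lemma smoothb_cst n (c : R) : smoothb n (fun=> c).
Proof.
elim: n c => [|n IHn] c; first by split=> //; exists `|c|.
apply: (@smoothbS _ _ (fun=> 0)); [by exists `|c| |exact: IHn].
Qed.

Lemma smoothbZ n c f : smoothb n f -> smoothb n (fun v => c * f v).
Proof. by apply: smoothbM; exact: smoothb_cst. Qed.

(* Since (exp F)' = F' exp F, only exp F itself and F' have to be controlled. *)
Lemma smoothb_expR n F df : bounded_halfline (fun v => expR (F v)) ->
  (forall v : R, is_derive v 1 F (df v)) -> (forall n, smoothb n df) ->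
  smoothb n (fun v => expR (F v)).
Proof.
move=> eb FdF sdf; elim: n => [|n IHn]; first by split.
apply: (@smoothbS _ _ (fun v => expR (F v) * df v)) => //.
exact: smoothbM IHn (sdf n).
Qed.

Lemma smoothb_test f : (forall n, smoothb n f) -> test_fun f.
Proof.
move=> sf.
(* Order [n.+1] is needed because the derivative of order [n] must itself be derivable. *)
suff H : forall n f, smoothb n.+1 f ->
    (forall v : R, derivable (derive1n n f) v 1) /\
    bounded_halfline (derive1n n f).
  by split => n; have [] := H n f (sf _).
elim=> [g [gb [dg _]]|n IHn g [_ [_ sg]]]; first by rewrite derive1n0.
by rewrite derive1Sn; exact: IHn.
Qed.

End smooth_bounded.

(** * Integration on the half-line *)

Section product_integral.
Context {d1 d2 : measure_display} {T1 : measurableType d1}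
  {T2 : measurableType d2} {R : realType}.
Variables (m1 : {sigma_finite_measure set T1 -> \bar R})
  (m2 : {sigma_finite_measure set T2 -> \bar R}).
Variables (A : set T1) (B : set T2) (f : T1 -> R) (g : T2 -> R).
Hypotheses (mA : measurable A) (mB : measurable B).
Hypotheses (fi : m1.-integrable A (EFin \o f))
  (gi : m2.-integrable B (EFin \o g)).

(** Extending both factors by 0 turns the integral over a rectangle into one over the whole product
    space, where Tonelli gives integrability and Fubini the value. *)
Let h (z : T1 * T2) := ((f \_ A) z.1 * (g \_ B) z.2)%:E.

Let hE : h = (fun z => (f z.1 * g z.2)%:E) \_ (A `*` B).
Proof.
apply/funext => -[x y]; rewrite /h /patch /= .
rewrite (_ : ((x, y) \in A `*` B) = (x \in A) && (y \in B)); last first.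
  by apply/idP/andP; rewrite !inE.
by case: (x \in A); case: (y \in B); rewrite ?mul0r ?mulr0.
Qed.

Let fi' : m1.-integrable setT (EFin \o (f \_ A)).
Proof. by rewrite -restrict_EFin; apply/(integrable_mkcond _ mA). Qed.

Let gi' : m2.-integrable setT (EFin \o (g \_ B)).
Proof. by rewrite -restrict_EFin; apply/(integrable_mkcond _ mB). Qed.

Let ih : (m1 \x m2)%E.-integrable setT h.
Proof.
have mf : measurable_fun [set: T1] (f \_ A).
  by apply/measurable_EFinP; case/integrableP: fi'.
have mg : measurable_fun [set: T2] (g \_ B).
  by apply/measurable_EFinP; case/integrableP: gi'.
have mh : measurable_fun setT h.
  apply/measurable_EFinP/measurable_funM.
    exact: measurableT_comp mf measurable_fst.
  exact: measurableT_comp mg measurable_snd.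
  apply/integrable12ltyP => //.
  under eq_integral => x _.
    rewrite /h /=.
    under eq_integral => y _ do rewrite normrM EFinM.
    rewrite ge0_integralZl//; last first.
      by do 2 apply: measurableT_comp => //.
    over.
  rewrite ge0_integralZr//; last 2 first.
  - by do 2 apply: measurableT_comp => //.
  - exact: integral_ge0.
  case/integrableP: fi' => _; case/integrableP: gi' => _ /=.
  set a := integral _ _ _; set b := integral _ _ _ => bf af.
  have fa : b \is a fin_num by rewrite ge0_fin_numE//; exact: integral_ge0.
  have fb : a \is a fin_num by rewrite ge0_fin_numE//; exact: integral_ge0.
  by rewrite -(fineK fa) -(fineK fb) -EFinM ltry.
Qed.

Lemma integrable_prodM :
  (m1 \x m2)%E.-integrable (A `*` B) (fun z => (f z.1 * g z.2)%:E).
Proof.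
by apply/integrable_mkcond; rewrite -?hE//; exact: measurableX.
Qed.

Lemma Rintegral_prodM :
  \int[(m1 \x m2)%E]_(z in A `*` B) (f z.1 * g z.2) =
  (\int[m1]_(x in A) f x) * \int[m2]_(y in B) g y.
Proof.
rewrite {1}/Rintegral integral_mkcond.
rewrite -hE.
rewrite -integral12_prod_meas1//.
have -> : fubini_F m2 h =
    fun x => ((f \_ A) x * \int[m2]_(y in B) g y)%:E.
  apply/funext => x; rewrite /fubini_F /h /=.
  under eq_integral do rewrite EFinM.
  rewrite integralZl// EFinM; congr (_ * _)%E.
  by rewrite Rintegral_mkcond /Rintegral fineK//; exact: integrable_fin_num.
under eq_integral do rewrite EFinM muleC.
rewrite integralZl//= fineM//; last exact: integrable_fin_num.
by rewrite mulrC [X in _ = X * _]Rintegral_mkcond.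
Qed.

End product_integral.

Section halfline_integrals.
Context {R : realType}.
Implicit Types (mu : proba R) (f g : R -> R).

Let H : set (measurableTypeR R) := @halfline R.

Lemma halflineP (v : R) : halfline v <-> 0 <= v.
Proof. by rewrite /halfline /= in_itv/= andbT. Qed.

Lemma measurable_halfline : measurable H.
Proof. exact: measurable_itv. Qed.

Lemma measurable_halfline2 : measurable (H `*` H).
Proof. exact: measurableX measurable_halfline measurable_halfline. Qed.

Lemma halfline_mass mu : mu (~` H) = 0%E -> mu H = 1%E.
Proof.
move=> mu0; have := probability_setC mu (measurableC measurable_halfline).
by rewrite setCK mu0 sube0.
Qed.

Lemma bounded_integrable mu f C : measurable_fun [set: measurableTypeR R] f ->
  (forall v, 0 <= v -> `|f v| <= C) -> mu.-integrable H (EFin \o f).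
Proof.
move=> mf fC; apply: measurable_bounded_integrable.
- exact: measurable_halfline.
- by rewrite (le_lt_trans (probability_le1 _ measurable_halfline)) ?ltry.
- exact: measurable_funS mf.
- exists C; split; first exact: num_real.
  by move=> x Cx v /halflineP v0; apply: (le_trans (fC _ v0)); exact: ltW.
Qed.

Lemma integrable_dominated mu f g : measurable_fun [set: measurableTypeR R] f ->
  mu.-integrable H (EFin \o g) -> (forall v, 0 <= v -> `|f v| <= g v) ->
  mu.-integrable H (EFin \o f).
Proof.
move=> mf ig fg; apply: le_integrable ig => //.
- exact: measurable_halfline.
- by apply/measurable_EFinP; exact: measurable_funS mf.
- move=> v /halflineP v0; rewrite /= lee_fin (le_trans (fg _ v0))//.
  exact: ler_norm.
Qed.

Lemma integral_halfline_cst mu c : mu (~` H) = 0%E ->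
  \int[mu]_(v in H) (fun=> c) v = c.
Proof.
move=> mu0; rewrite (Rintegral_cst mu measurable_halfline).
by rewrite [X in fine X](halfline_mass mu0) mulr1.
Qed.

End halfline_integrals.

(** * Comparison with supersolutions *)

Section comparison.
Context {R : realType}.
Implicit Types (F Q y dy : R -> R) (l K : R).

(* [F] behaves as a solution of F' = Q - F with F(0+) = l, as far as
   upper bounds by supersolutions [y] are concerned. *)
Definition subsolution F Q l : Prop := forall y dy,
  (forall t : R, is_derive t 1 y (dy t)) ->
  (forall t : R, 0 < t -> Q t <= y t + dy t) -> l <= y 0 ->
  forall t : R, 0 < t -> F t <= y t.

Lemma derive_subsolution F Q l :
  (forall t : R, 0 < t -> is_derive t 1 F (Q t - F t)) ->
  F t @[t --> 0^'+] --> l -> subsolution F Q l.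
Proof.
move=> dF Fl y dy hy Qy ly t t0.
pose G s := expR s * (F s - y s).
have dG (s : R) : 0 < s -> is_derive s 1 G (expR s * (Q s - (y s + dy s))).
  move=> s0; have := dF s s0 => ?; have := hy s => ?.
  apply: is_derive_eq; rewrite /GRing.scale /=; ring.
have G_nincr s : 0 < s -> s <= t -> G t <= G s.
  move=> s0 st.
  have pos x : x \in `[s, t] -> 0 < x.
    by rewrite in_itv/= => /andP[+ _]; exact: lt_le_trans.
  have dGx x : x \in `[s, t] -> derivable G x 1.
    by move=> /pos x0; exact: (@ex_derive _ _ _ _ _ _ _ (dG x x0)).
  apply: (@ler0_derive1_le_cc _ G s t); rewrite ?in_itv/= ?lexx ?st//.
  - by move=> x /subset_itv_oo_cc; exact: dGx.
  - move=> x /subset_itv_oo_cc/pos x0.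
    rewrite derive1E (@derive_val _ _ _ _ _ _ _ (dG x x0)).
    by rewrite mulr_ge0_le0 ?expR_ge0// subr_le0 Qy.
  - exact: derivable_within_continuous.
have cG : G s @[s --> 0^'+] --> l - y 0.
  rewrite -[l - y 0]mul1r -[X in X * _]expR0.
  apply: cvgM; first by apply: cvg_at_right_filter; exact: continuous_expR.
  apply: cvgB => //; apply: cvg_at_right_filter.
  apply: differentiable_continuous; apply/derivable1_diffP.
  exact: (@ex_derive _ _ _ _ _ _ _ (hy 0)).
have : G t <= l - y 0.
  apply: (cvgr_to_ge cG).
  near=> s; apply: G_nincr; first by near: s; exact: nbhs_right_gt.
  by near: s; exact: nbhs_right_le.
rewrite /G => Gly.
have : expR t * (F t - y t) <= 0 by rewrite (le_trans Gly)// subr_le0.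
by rewrite pmulr_rle0 ?expR_gt0// subr_le0.
Unshelve. all: by end_near. Qed.

(** Stability under uniform approximation: raising the supersolution by e/2 absorbs the errors in
    [Q] and [l], and another e/2 pays for replacing [F] by [F']. This admits test functions that are
    not smooth. *)
Lemma subsolution_approx F Q l :
  (forall e : R, 0 < e -> exists F' Q' l', [/\ subsolution F' Q' l',
     forall t : R, 0 < t -> F t <= F' t + e,
     forall t : R, 0 < t -> Q' t <= Q t + e & l' <= l + e]) ->
  subsolution F Q l.
Proof.
move=> H y dy hy Qy ly t t0; apply/ler_addgt0Pr => e e0.
have e20 : 0 < e / 2 by rewrite divr_gt0.
have [F' [Q' [l' [sub FF QQ ll]]]] := H _ e20.
apply: (le_trans (FF t t0)); rewrite [e in leRHS]splitr addrA lerD2r.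
have hy' (s : R) : is_derive s 1 (fun s => y s + e / 2) (dy s).
  have := hy s => ?; rewrite -[dy s]addr0; exact: is_deriveD.
apply: (sub _ _ hy') => //.
- move=> s s0; rewrite addrAC (le_trans (QQ s s0))// lerD2r; exact: Qy.
- by rewrite (le_trans ll)// lerD2r.
Qed.

(* The error S exp(Kt) with which Y dominates U can be halved repeatedly. *)
Lemma comparison (I : Type) (U Q Y dY : I -> R -> R) (l : I -> R) K S0 :
  (forall i, subsolution (U i) (Q i) (l i)) ->
  (forall i (t : R), is_derive t 1 (Y i) (dY i t)) ->
  (forall i, l i <= Y i 0) ->
  0 <= S0 -> 0 <= K -> (forall i (t : R), 0 < t -> U i t <= Y i t + S0) ->
  (forall S : R, 0 <= S ->
    (forall i (t : R), 0 < t -> U i t <= Y i t + S * expR (K * t)) ->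
    forall i (t : R), 0 < t ->
      Q i t <= Y i t + dY i t + (K + 1) / 2 * S * expR (K * t)) ->
  forall i (t : R), 0 < t -> U i t <= Y i t.
Proof.
move=> sub hY lY S00 K0 US0 step.
have key n : forall i (t : R), 0 < t -> U i t <= Y i t + S0 / 2 ^+ n * expR (K * t).
  elim: n => [|n IHn] i t t0.
    rewrite expr0 divr1 (le_trans (US0 i t t0))// lerD2l ler_peMr//.
    by rewrite -expR0 ler_expR mulr_ge0// ltW.
  have S0n : 0 <= S0 / 2 ^+ n by rewrite divr_ge0// exprn_ge0.
  have := step _ S0n IHn i => {}step.
  set S := S0 / 2 ^+ n.+1.
  have SE : S0 / 2 ^+ n = 2 * S.
    by rewrite /S exprSr invfM; field; rewrite expf_neq0.
  (* Value plus derivative of S exp(Ks) is (K + 1) S exp(Ks), exactly the error that [step] produces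
     from the previous bound 2S. Hence the raised function is again a supersolution. *)
  have hy (s : R) : is_derive s 1 (fun s => Y i s + S * expR (K * s))
     (dY i s + S * (K * expR (K * s))).
    have := hY i s => ?.
    by apply: is_derive_eq; rewrite /GRing.scale /=; ring.
  apply: (sub i _ _ hy) => //.
  - move=> s s0; rewrite (le_trans (step s s0))// SE le_eqVlt.
    by apply/orP; left; apply/eqP; field.
  - rewrite (le_trans (lY i))// lerDl mulr_ge0 ?expR_ge0//.
    by rewrite divr_ge0// exprn_ge0.
move=> i t t0; apply/ler_addgt0Pr => e e0.
have : S0 * expR (K * t) * 2^-1 ^+ n @[n --> \oo] --> S0 * expR (K * t) * 0.
  apply: cvgMr; apply: cvg_expr; rewrite gtr0_norm//; lra.
rewrite mulr0 => /cvgrPdist_le /(_ e e0) [N _ /(_ N (leqnn N))] /=.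
rewrite sub0r normrN => He.
apply: (le_trans (key N i t t0)); rewrite lerD2l.
by rewrite (le_trans _ He)// (le_trans _ (ler_norm _))// exprVn mulrAC.
Qed.

End comparison.

(** * Trigonometric and damped power test functions *)

Section test_functions.
Context {R : realType}.
Implicit Types (f : R -> R) (n : nat) (a b c xi : R).

Lemma smoothb_comp_scale n c f : 0 <= c -> smoothb n f ->
  smoothb n (fun v => f (c * v)).
Proof.
move=> c0; elim: n f => [|n IHn] f sf.
  split => //; case: sf => -[C fC] _.
  by exists C => v v0; apply: fC; rewrite mulr_ge0.
have [[C fC] [df sf']] := sf.
apply: (@smoothbS _ _ _ (fun v => c * derive1 f (c * v))).
- by exists C => v v0; apply: fC; rewrite mulr_ge0.
- move=> v; have := smoothb_deriv (c * v) sf => ?.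
  have dl : is_derive v 1 (fun v : R => c * v) c.
    by apply: is_derive_eq; rewrite /GRing.scale /= mulr1.
  rewrite mulrC; exact: (@is_derive1_comp _ f (fun v => c * v) v _ _ _ dl).
- by apply: smoothbZ; exact: IHn.
Qed.

Lemma smoothb_trig n a b xi :
  smoothb n (fun v => a * cos (xi * v) + b * sin (xi * v)).
Proof.
have bdd a' b' : bounded_halfline (fun v => a' * cos (xi * v) + b' * sin (xi * v)).
  exists (`|a'| + `|b'|) => v _; rewrite (le_trans (ler_normD _ _))// !normrM.
  by rewrite lerD// ler_piMr// ?cos_max ?sin_max.
elim: n a b => [|n IHn] a b; first by split.
apply: (@smoothbS _ _ _
  (fun v => (b * xi) * cos (xi * v) + (- a * xi) * sin (xi * v))) => //.
by move=> v; apply: is_derive_eq; rewrite /GRing.scale/=; ring.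
Qed.

Lemma smoothb_expN n (eps : R) : 0 <= eps ->
  smoothb n (fun v => expR (- (eps * v))).
Proof.
move=> e0; apply: (@smoothb_expR _ _ _ (fun=> - eps)).
- exists 1 => v v0; rewrite ger0_norm ?expR_ge0// -expR0 ler_expR oppr_le0.
  exact: mulr_ge0.
- by move=> v; apply: is_derive_eq; rewrite /GRing.scale/=; ring.
- by move=> k; exact: smoothb_cst.
Qed.

(** The derivatives of 1/(c + v^2) and v/(c + v^2) are polynomials in these same two functions, so
    the induction on the order carries both at once. *)
Lemma smoothb_rational n c : 0 < c ->
  smoothb n (fun v => v / (c + v ^+ 2)).
Proof.
move=> c0.
have cv v : 0 < c + v ^+ 2 by rewrite ltr_wpDr// sqr_ge0.
have cv0 v : c + v ^+ 2 != 0 by rewrite gt_eqF.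
suff : smoothb n (fun v => (c + v ^+ 2)^-1) /\
    smoothb n (fun v => v / (c + v ^+ 2)) by case.
have b1 : bounded_halfline (fun v => (c + v ^+ 2)^-1).
  exists c^-1 => v _; rewrite ger0_norm ?invr_ge0 ?(ltW (cv v))// lef_pV2 ?posrE//.
  by rewrite lerDl sqr_ge0.
have b2 : bounded_halfline (fun v => v / (c + v ^+ 2)).
  exists (1 + c^-1) => v v0; rewrite ger0_norm ?divr_ge0 ?(ltW (cv v))//.
  rewrite ler_pdivrMr// mulrDl mul1r mulrDr mulVf ?gt_eqF//.
  have := mulr_ge0 (ltW (divr_gt0 ltr01 c0)) (sqr_ge0 v); rewrite div1r.
  nra.
elim: n => [|n [IH1 IH2]]; first by split.
split.
- apply: (@smoothbS _ _ _ (fun v => (- 2) *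
     ((v / (c + v ^+ 2)) * (c + v ^+ 2)^-1))) => //.
  + move=> v; apply: is_derive_eq; rewrite /GRing.scale/=.
    by field.
  + by apply: smoothbZ; exact: smoothbM.
- apply: (@smoothbS _ _ _ (fun v => (c + v ^+ 2)^-1 + (- 2) *
     ((v / (c + v ^+ 2)) * (v / (c + v ^+ 2))))) => //.
  + move=> v; apply: is_derive_eq; rewrite /GRing.scale/=.
    by field.
  + by apply: smoothbD => //; apply: smoothbZ; exact: smoothbM.
Qed.

End test_functions.

(** * Convexity and interpolation inequalities for real powers *)

Section power_inequalities.
Context {R : realType}.
Implicit Types (s x y a lambda theta eta : R).

(** With y = exp(L) and exp(theta L) factored out, this is a weighted sum of exp(x) >= 1 + x at x =
    - theta L and x = (1 - theta) L; the linear terms cancel. *)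
Lemma powR_le_chord theta y : 0 <= theta <= 1 -> 0 < y ->
  y `^ theta <= 1 - theta + theta * y.
Proof.
move=> /andP[t0 t1] y0.
have [L ->] : exists L, y = expR L by exists (ln y); rewrite lnK.
rewrite /powR gt_eqF ?expR_gt0// expRK.
have -> : expR L = expR (theta * L) * expR ((1 - theta) * L).
  by rewrite -expRD; congr expR; ring.
rewrite [X in _ <= X + _](_ : _ = (1 - theta) *
    (expR (theta * L) * expR (- (theta * L)))); last first.
  by rewrite expRxMexpNx_1 mulr1.
move: (expR_ge1Dx ((1 - theta) * L)) (expR_ge1Dx (- (theta * L))).
move: (expR_ge0 (theta * L)).
move: (expR _) (expR _) (expR _) => C B A A0 hB hC; rewrite -subr_ge0.
rewrite (_ : _ - _ = A * ((1 - theta) * (C - (1 + - (theta * L))) +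
  theta * (B - (1 + (1 - theta) * L)))); last by ring.
by rewrite mulr_ge0// addr_ge0// mulr_ge0// subr_ge0.
Qed.

(** By homogeneity it reduces to Bernoulli's inequality s u <= s - 1 + u^s for u = x/a, which is
    [powR_le_chord] with exponent 1/s at u^s. The case x = 0 is separate, as the chord bound needs a
    positive argument. *)
Lemma powR_ge_tangent s x a : 1 <= s -> 0 <= x -> 0 < a ->
  a `^ s - s * (a - x) * a `^ (s - 1) <= x `^ s.
Proof.
move=> s1 x0 a0.
have s0 : 0 < s by rewrite (lt_le_trans _ s1).
have -> : a `^ s = a * a `^ (s - 1) by rewrite mulr_powRB1// ltW.
move: x0; rewrite le_eqVlt => /predU1P[<-|x0].
  rewrite subr0 powR0 ?gt_eqF//.
  rewrite -subr_ge0 (_ : _ - _ = (s - 1) * (a * a `^ (s - 1))); last by ring.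
  by rewrite mulr_ge0 ?subr_ge0// mulr_ge0 ?powR_ge0// ltW.
pose u := x / a; have u0 : 0 < u by rewrite divr_gt0.
have xE : x = a * u by rewrite /u mulrC divfK// gt_eqF.
rewrite xE powRM ?(ltW a0) ?(ltW u0)// -(mulr_powRB1 (ltW a0) s0).
have := @powR_le_chord s^-1 (u `^ s).
rewrite invr_ge0 (ltW s0) invf_le1// s1 powR_gt0// => /(_ isT isT).
rewrite -powRrM mulfV ?gt_eqF// powRr1 ?(ltW u0)// => h.
have {}h : s * u <= s - 1 + u `^ s.
  have -> : s - 1 + u `^ s = s * (1 - s^-1 + s^-1 * u `^ s).
    by field; rewrite gt_eqF.
  by rewrite ler_pM2l.
move: (powR_gt0 (s - 1) a0); move: (a `^ (s - 1)) => B B0.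
rewrite -subr_ge0 (_ : _ - _ = a * B * (s - 1 + u `^ s - s * u)); last by ring.
by rewrite mulr_ge0 ?subr_ge0// mulr_ge0 ?ltW.
Qed.

(** By symmetry y <= x. The tangent at x + y bounds the increment by s y (x + y)^(s-1), and x + y <=
    2x. Each cross term is linear in one variable, so its integral involves only the mean of that
    variable. *)
Lemma powRD_le s x y : 1 <= s -> 0 <= x -> 0 <= y ->
  (x + y) `^ s <= x `^ s + y `^ s +
    s * 2 `^ s * (x `^ (s - 1) * y + x * y `^ (s - 1)).
Proof.
move=> s1 x0 y0.
wlog yx : x y x0 y0 / y <= x.
  move=> H; case: (leP y x) => [|/ltW] xy; first exact: H.
  by move: (H y x y0 x0 xy); rewrite addrC; congr (is_true (_ <= _)); ring.
have s0 : 0 < s by rewrite (lt_le_trans _ s1).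
move: x0; rewrite le_eqVlt => /predU1P[x0|x0].
  have -> : y = 0 by apply/eqP; rewrite eq_le y0 andbT x0.
  by rewrite -x0 addr0 mul0r mulr0 !addr0 mulr0 addr0 powR0 ?gt_eqF// addr0.
have xy0 : 0 < x + y by rewrite ltr_pwDl.
have := @powR_ge_tangent s x (x + y) s1 (ltW x0) xy0.
rewrite (addrC x y) addrK (addrC y x) lerBlDr => /le_trans; apply.
rewrite -addrA lerD2l; apply: le_trans (_ : s * 2 `^ s * (x `^ (s - 1) * y) <= _).
  rewrite -!mulrA ler_pM2l// mulrC mulrA ler_wpM2r//.
  apply: (@le_trans _ _ ((2 * x) `^ (s - 1))).
    apply: ge0_ler_powR; rewrite ?nnegrE;
      [by rewrite subr_ge0|exact: ltW|by rewrite mulr_ge0// ltW|].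
    by rewrite mulr2n mulrDl mul1r lerD2l.
  rewrite powRM// ?(ltW x0)// ler_wpM2r ?powR_ge0//.
  by rewrite ler_powR ?ler1n// gerBl.
rewrite mulrDr addrCA lerDl addr_ge0 ?powR_ge0// !mulr_ge0 ?powR_ge0 ?(ltW s0)//.
exact: ltW.
Qed.

(** Split at x = 1/lambda: above it lambda x >= 1, below it monotonicity suffices. A small lambda
    makes the power s - 1 cheap compared with the power s. *)
Lemma powR_interpolation s lambda x : 1 <= s -> 0 < lambda -> 0 <= x ->
  x `^ (s - 1) <= lambda * x `^ s + (lambda^-1) `^ (s - 1).
Proof.
move=> s1 l0 x0; have s0 : 0 < s by rewrite (lt_le_trans _ s1).
have [xl|/ltW lx] := leP x lambda^-1.
  rewrite -[leLHS]add0r lerD ?mulr_ge0 ?powR_ge0 ?(ltW l0)//.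
  by apply: ge0_ler_powR; rewrite ?nnegrE ?subr_ge0 ?invr_ge0 ?(ltW l0).
rewrite -[leLHS]addr0 lerD ?powR_ge0// -(mulr_powRB1 x0 s0) mulrA.
rewrite ler_peMl ?powR_ge0//.
by rewrite -[leLHS](mulfV (lt0r_neq0 l0)) ler_pM2l.
Qed.

(** Raise x/s <= exp(x/s) to the power s. *)
Lemma powR_expN_bounded s x : 0 < s -> 0 <= x ->
  x `^ s * expR (- x) <= s `^ s.
Proof.
move=> s0 x0; rewrite expRN -ler_pdivlMr ?invr_gt0 ?expR_gt0// invrK.
have {1}-> : x = s * (x / s) by rewrite mulrC divfK ?gt_eqF.
rewrite powRM ?divr_ge0 ?(ltW s0)// ler_wpM2l ?powR_ge0//.
have -> : expR x = expR (x / s) `^ s.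
  by rewrite /powR gt_eqF ?expR_gt0// expRK mulrC divfK ?gt_eqF.
apply: ge0_ler_powR; rewrite ?nnegrE ?expR_ge0 ?divr_ge0 ?(ltW s0)//.
by rewrite (le_trans _ (expR_ge1Dx _))// lerDr.
Qed.

End power_inequalities.

(** * The damped power and its smooth regularization *)

Section truncated_power.
Context {R : realType}.
Implicit Types (s h x y lambda mu : R).

Definition psi s x := x `^ s * expR (- x).

(* [psi s] is not smooth at 0 unless s is an integer; [psi_reg s h] is an
   admissible test function. *)
Definition psi_reg s h x := expR (s / 2 * ln (h ^+ 2 + x ^+ 2) - x).

Lemma measurable_psi s : measurable_fun [set: R] (psi s).
Proof.
apply: measurable_funM; first exact: measurable_powR.
by apply: measurableT_comp => //; exact: measurable_expR.
Qed.

Lemma psi_ge0 s x : 0 <= psi s x.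
Proof. by rewrite mulr_ge0 ?powR_ge0 ?expR_ge0. Qed.

Lemma psi_le s x : 0 < s -> 0 <= x -> psi s x <= s `^ s.
Proof. exact: powR_expN_bounded. Qed.

Lemma psi_le_powR s x : 0 <= x -> psi s x <= x `^ s.
Proof.
move=> x0; rewrite ler_piMr ?powR_ge0// -expR0 ler_expR.
by rewrite oppr_le0.
Qed.

Lemma psi_regE s h x : 0 < h ->
  psi_reg s h x = (h ^+ 2 + x ^+ 2) `^ (s / 2) * expR (- x).
Proof.
move=> h0; rewrite /psi_reg expRD /powR gt_eqF//.
by rewrite ltr_pwDl ?exprn_gt0// sqr_ge0.
Qed.

Lemma powR_sqr_half s x : 0 <= x -> (x ^+ 2) `^ (s / 2) = x `^ s.
Proof.
by move=> x0; rewrite -(powR_mulrn 2 x0) -powRrM mulrC divfK ?pnatr_eq0.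
Qed.

Lemma psi_le_reg s h x : 0 <= s -> 0 < h -> 0 <= x -> psi s x <= psi_reg s h x.
Proof.
move=> s0 h0 x0; rewrite psi_regE// ler_wpM2r ?expR_ge0//.
rewrite -(powR_sqr_half s x0).
apply: ge0_ler_powR; rewrite ?nnegrE ?divr_ge0 ?addr_ge0 ?sqr_ge0//.
by rewrite lerDr sqr_ge0.
Qed.

Lemma psi_reg_le s h x : 0 <= s -> 0 < h -> 0 <= x ->
  psi_reg s h x <= (x + h) `^ s * expR (- x).
Proof.
move=> s0 h0 x0; rewrite psi_regE// ler_wpM2r ?expR_ge0//.
have xh : 0 <= x + h by rewrite addr_ge0// ltW.
rewrite -(powR_sqr_half s xh).
apply: ge0_ler_powR; rewrite ?nnegrE ?divr_ge0 ?addr_ge0 ?sqr_ge0//.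
rewrite -subr_ge0 (_ : _ - _ = 2 * x * h); last by ring.
by rewrite !mulr_ge0// ltW.
Qed.

Lemma shifted_power_bounded s h x : 0 < s -> 0 < h -> 0 <= x ->
  (x + h) `^ s * expR (- x) <= s `^ s * expR h.
Proof.
move=> s0 h0 x0.
have -> : expR (- x) = expR (- (x + h)) * expR h.
  by rewrite -expRD; congr expR; ring.
by rewrite mulrA ler_wpM2r ?expR_ge0// powR_expN_bounded// addr_ge0// ltW.
Qed.

Lemma smoothb_psi_reg n s h : 0 < s -> 0 < h -> smoothb n (psi_reg s h).
Proof.
move=> s0 h0; have h20 : 0 < h ^+ 2 by rewrite exprn_gt0.
apply: (@smoothb_expR _ _ _ (fun v => s * (v / (h ^+ 2 + v ^+ 2)) + -1)).
- exists (s `^ s * expR h) => v v0; rewrite ger0_norm ?expR_ge0//.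
  by rewrite (le_trans (psi_reg_le _ _ _)) ?(ltW s0)// shifted_power_bounded.
- move=> v; have hv : 0 < h ^+ 2 + v ^+ 2 by rewrite ltr_wpDr// sqr_ge0.
  have := is_derive1_ln hv => ?.
  have dw : is_derive v 1 (fun v => h ^+ 2 + v ^+ 2) (2 * v).
    by apply: is_derive_eq; rewrite /GRing.scale/=; ring.
  have := @is_derive1_comp _ (@ln R) (fun v => h ^+ 2 + v ^+ 2) v _ _ _ dw => ?.
  by apply: is_derive_eq; rewrite /GRing.scale/=; field; rewrite gt_eqF.
- move=> k; apply: smoothbD; last exact: smoothb_cst.
  by apply: smoothbZ; exact: smoothb_rational.
Qed.

(** The tangent inequality at x + h bounds the error by s h (x + h)^(s-1) exp(-x), and interpolation
    with lambda = 1 makes this O(h) uniformly in x >= 0. *)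
Lemma psi_reg_approx s (e : R) : 1 <= s -> 0 < e -> exists h, 0 < h /\
  forall x, 0 <= x -> `|psi_reg s h x - psi s x| <= e.
Proof.
move=> s1 e0; have s0 : 0 < s by rewrite (lt_le_trans _ s1).
(* The uniform constant of the O(h) bound for h <= 1: the first summand bounds (x + h)^s exp(-x),
   the second exp(-x). *)
pose C := s * (s `^ s * expR 1 + 1).
have C0 : 0 < C by rewrite mulr_gt0// ltr_wpDl// mulr_ge0 ?powR_ge0 ?expR_ge0.
exists (Num.min 1 (e / C)); set h := Num.min _ _.
have h0 : 0 < h by rewrite lt_min ltr01 divr_gt0.
have h1 : h <= 1 by rewrite ge_min lexx.
have hC : h * C <= e by rewrite -ler_pdivlMr// ge_min lexx orbT.
split=> // x x0; have xh : 0 < x + h by rewrite ltr_wpDl.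
rewrite ger0_norm; last by rewrite subr_ge0 psi_le_reg// ltW.
rewrite (le_trans _ hC)// lerBlDr (le_trans (psi_reg_le _ _ _)) ?(ltW s0)//.
have := powR_ge_tangent s1 x0 xh; rewrite addrAC subrr add0r lerBlDr => H.
rewrite (le_trans (ler_wpM2r (expR_ge0 _) H))// mulrDl addrC lerD2r.
rewrite (_ : _ * expR _ = h * (s * ((x + h) `^ (s - 1) * expR (- x)))); last by ring.
rewrite /C !ler_pM2l//.
have := @powR_interpolation _ s 1 (x + h) s1 ltr01 (ltW xh).
rewrite mul1r invr1 powR1 => /(ler_wpM2r (expR_ge0 (- x)))/le_trans; apply.
rewrite mulrDl mul1r lerD//.
  by rewrite (le_trans (shifted_power_bounded _ _ _))// ler_wpM2l ?powR_ge0// ler_expR.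
by rewrite -expR0 ler_expR oppr_le0.
Qed.

(** Since exp(-(x + y)) factors, [powRD_le] can be multiplied by it and each cross term interpolated
    separately. The two parameters stay free so that [gain_psi_le] can fit them to the mean. *)
Lemma psiD_le s lambda mu x y : 1 <= s -> 0 < lambda -> 0 < mu ->
  0 <= x -> 0 <= y ->
  psi s (x + y) <= psi s x + psi s y + s * 2 `^ s *
    ((lambda * psi s x + lambda^-1 `^ (s - 1)) * y +
     x * (mu * psi s y + mu^-1 `^ (s - 1))).
Proof.
move=> s1 l0 m0 x0 y0; have s0 : 0 < s by rewrite (lt_le_trans _ s1).
have C0 : 0 <= s * 2 `^ s by rewrite mulr_ge0 ?powR_ge0// ltW.
have key (l z : R) : 0 < l -> 0 <= z ->
    z `^ (s - 1) * expR (- z) <= l * psi s z + l^-1 `^ (s - 1).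
  move=> l0' z0.
  apply: le_trans (ler_wpM2r (expR_ge0 _) (powR_interpolation s1 l0' z0)) _.
  rewrite mulrDl /psi mulrA lerD2l ler_piMr ?powR_ge0// -expR0 ler_expR.
  by rewrite oppr_le0.
have e1 (z : R) : 0 <= z -> expR (- z) <= 1.
  by move=> z0; rewrite -expR0 ler_expR oppr_le0.
have kx := key _ _ l0 x0; have ky := key _ _ m0 y0.
rewrite {1}/psi opprD expRD.
have exy : 0 <= expR (- x) * expR (- y) by rewrite mulr_ge0 ?expR_ge0.
apply: le_trans (ler_wpM2r exy (powRD_le s1 x0 y0)) _.
rewrite [leLHS](_ : _ = psi s x * expR (- y) + psi s y * expR (- x) +
  s * 2 `^ s * (x `^ (s - 1) * expR (- x) * y * expR (- y) +
    x * (y `^ (s - 1) * expR (- y)) * expR (- x))); last by rewrite /psi; ring.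
have le1 (a z : R) : 0 <= a -> 0 <= z -> a * expR (- z) <= a.
  by move=> a0 z0; rewrite ler_piMr// e1.
apply: lerD; first by rewrite lerD ?le1 ?psi_ge0.
rewrite ler_wpM2l// lerD//.
- by rewrite (le_trans (le1 _ y _ y0)) ?ler_wpM2r// !mulr_ge0 ?powR_ge0 ?expR_ge0.
- by rewrite (le_trans (le1 _ x _ x0)) ?ler_wpM2l// !mulr_ge0 ?powR_ge0 ?expR_ge0.
Qed.

End truncated_power.

(** * Weak solutions and the gain term *)

Section gain.
Context {R : realType}.
Implicit Types (mu : proba R) (f phi : R -> R) (p q C : R).

Let H : set (measurableTypeR R) := @halfline R.

Definition gain p q phi mu : R :=
  \int[(mu \x mu)%E]_(z in H `*` H) phi (p * z.1 + q * z.2).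

Lemma halfline2P (z : R * R) :
  (halfline `*` halfline) z <-> 0 <= z.1 /\ 0 <= z.2.
Proof. by split=> -[] /halflineP ? /halflineP ?. Qed.

Lemma bounded_integrable2 mu (k : R * R -> R) C :
  measurable_fun [set: measurableTypeR R * measurableTypeR R] k ->
  (forall x y, 0 <= x -> 0 <= y -> `|k (x, y)| <= C) ->
  (mu \x mu)%E.-integrable (H `*` H) (EFin \o k).
Proof.
move=> mk kC; apply: measurable_bounded_integrable.
- exact: measurable_halfline2.
- rewrite (le_lt_trans (probability_le1 _ (measurable_halfline2))) ?ltry//.
- exact: measurable_funS mk.
- exists C; split; first exact: num_real.
  move=> M CM [x y] /halfline2P[/= x0 y0].
  by apply: (le_trans (kC _ _ x0 y0)); exact: ltW.
Qed.

Lemma measurable_affine2 p q phi : measurable_fun [set: R] phi ->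
  measurable_fun [set: measurableTypeR R * measurableTypeR R]
    (fun z => phi (p * z.1 + q * z.2)).
Proof.
move=> mphi; apply: measurableT_comp => //.
by apply: measurable_funD; apply: measurable_funM.
Qed.

Lemma gain_integrable p q phi mu C : 0 <= p -> 0 <= q ->
  measurable_fun [set: R] phi -> (forall v, 0 <= v -> `|phi v| <= C) ->
  (mu \x mu)%E.-integrable (H `*` H)
    (EFin \o (fun z => phi (p * z.1 + q * z.2))).
Proof.
move=> p0 q0 mphi phiC; apply: (@bounded_integrable2 _ _ C).
  exact: measurable_affine2.
by move=> x y x0 y0; apply: phiC; rewrite addr_ge0// mulr_ge0.
Qed.

Lemma integrable_fst mu f : mu (~` H) = 0%E -> mu.-integrable H (EFin \o f) ->
  (mu \x mu)%E.-integrable (H `*` H) (fun z => (f z.1)%:E) /\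
  \int[(mu \x mu)%E]_(z in H `*` H) f z.1 = \int[mu]_(v in H) f v.
Proof.
move=> mu0 fi; have mH := @measurable_halfline R.
have i1 : mu.-integrable H (EFin \o (fun=> 1 : R)).
  by apply: (@bounded_integrable _ _ _ 1) => // v _; rewrite normr1.
split.
  apply: eq_integrable (integrable_prodM mH mH fi i1); first exact: measurable_halfline2.
  by move=> z _; rewrite mulr1.
rewrite -[RHS]mulr1 -[X in _ = _ * X](integral_halfline_cst 1 mu0).
by rewrite -(Rintegral_prodM mH mH fi i1); apply: eq_Rintegral => z _; rewrite mulr1.
Qed.

Lemma integrable_snd mu f : mu (~` H) = 0%E -> mu.-integrable H (EFin \o f) ->
  (mu \x mu)%E.-integrable (H `*` H) (fun z => (f z.2)%:E) /\
  \int[(mu \x mu)%E]_(z in H `*` H) f z.2 = \int[mu]_(v in H) f v.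
Proof.
move=> mu0 fi; have mH := @measurable_halfline R.
have i1 : mu.-integrable H (EFin \o (fun=> 1 : R)).
  by apply: (@bounded_integrable _ _ _ 1) => // v _; rewrite normr1.
split.
  apply: eq_integrable (integrable_prodM mH mH i1 fi); first exact: measurable_halfline2.
  by move=> z _; rewrite mul1r.
rewrite -[RHS]mul1r -[X in _ = X * _](integral_halfline_cst 1 mu0).
by rewrite -(Rintegral_prodM mH mH i1 fi); apply: eq_Rintegral => z _; rewrite mul1r.
Qed.

Lemma collisionE p q phi mu C : 0 <= p -> 0 <= q -> mu (~` H) = 0%E ->
  measurable_fun [set: R] phi -> (forall v, 0 <= v -> `|phi v| <= C) ->
  collision p q phi mu = gain p q phi mu - \int[mu]_(v in H) phi v.
Proof.
move=> p0 q0 mu0 mphi phiC.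
have phii : mu.-integrable H (EFin \o phi) by exact: bounded_integrable phiC.
have [i1 <-] := integrable_fst mu0 phii.
rewrite /collision RintegralB//; first exact: measurable_halfline2.
exact: gain_integrable phiC.
Qed.

Lemma test_fun_measurable phi : test_fun phi -> measurable_fun [set: R] phi.
Proof.
move=> [/(_ 0%N) dphi _]; apply: continuous_measurable_fun => v.
by apply: differentiable_continuous; apply/derivable1_diffP; exact: dphi.
Qed.

Lemma test_fun_bounded phi : test_fun phi ->
  exists C, forall v, 0 <= v -> `|phi v| <= C.
Proof. by move=> [_ /(_ 0%N)]. Qed.

End gain.

(** * Comparison property of weak solutions *)

Section weak_solutions.
Context {R : realType}.
Implicit Types (phi g : R -> R) (t e C D : R).
Variables (p q alpha : R) (f0 : proba R) (f : R -> proba R).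
Hypotheses (p0 : 0 <= p) (q0 : 0 <= q).
Hypothesis ws : weak_solution p q alpha f0 f.

Let f0H : f0 (~` halfline) = 0%E. Proof. by case: ws => -[]. Qed.

Let fH (t : R) : 0 < t -> f t (~` halfline) = 0%E.
Proof. by move=> t0; case: ws => _ /(_ t t0)[]. Qed.

Lemma weak_derive phi (t : R) : test_fun phi -> 0 < t ->
  is_derive t 1 (fun t => \int[f t]_(v in halfline) phi v)
    (gain p q phi (f t) - \int[f t]_(v in halfline) phi v).
Proof.
move=> tphi t0; have [C phiC] := test_fun_bounded tphi.
rewrite -(collisionE p0 q0 (fH t0) (test_fun_measurable tphi) phiC).
by case: ws => _ _ /(_ phi tphi)[/(_ t t0)].
Qed.

Lemma weak_initial phi : test_fun phi ->
  \int[f t]_(v in halfline) phi v @[t --> 0^'+] -->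
  \int[f0]_(v in halfline) phi v.
Proof. by move=> tphi; case: ws => _ _ /(_ phi tphi)[]. Qed.

(** Uniform approximation does not carry the time derivative over to [phi], but the comparison
    property passes to the limit, and nothing more is used later. *)
Lemma weak_subsolution phi : measurable_fun [set: R] phi ->
  (exists C, forall v, 0 <= v -> `|phi v| <= C) ->
  (forall e, 0 < e -> exists phi', test_fun phi' /\
     forall v, 0 <= v -> `|phi' v - phi v| <= e) ->
  subsolution (fun t => \int[f t]_(v in halfline) phi v)
    (fun t => gain p q phi (f t)) (\int[f0]_(v in halfline) phi v).
Proof.
move=> mphi [C phiC] approx; apply: subsolution_approx => e e0.
have [phi' [tphi' close]] := approx e e0.
have [C' phi'C] := test_fun_bounded tphi'.
have mphi' := test_fun_measurable tphi'.
exists (fun t => \int[f t]_(v in halfline) phi' v),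
  (fun t => gain p q phi' (f t)), (\int[f0]_(v in halfline) phi' v).
have mH := @measurable_halfline R; have mH2 := @measurable_halfline2 R.
(* A pointwise error e integrates to exactly e, because all the mass lies on the half-line. *)
have dist1 (mu : proba R) (g g' : R -> R) (D D' : R) : mu (~` halfline) = 0%E ->
    measurable_fun [set: R] g -> measurable_fun [set: R] g' ->
    (forall v, 0 <= v -> `|g v| <= D) -> (forall v, 0 <= v -> `|g' v| <= D') ->
    (forall v, 0 <= v -> g v <= g' v + e) ->
    \int[mu]_(v in halfline) g v <= \int[mu]_(v in halfline) g' v + e.
  move=> muH mg mg' gD gD' gg'.
  have ig := bounded_integrable mu mg gD.
  have ig' := bounded_integrable mu mg' gD'.
  have ie : mu.-integrable halfline (EFin \o (fun=> e)).
    by apply: (@bounded_integrable _ _ _ `|e|).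
  rewrite -[X in _ <= _ + X](integral_halfline_cst e muH) -RintegralD//.
  apply: le_Rintegral => //; last by move=> v /halflineP; exact: gg'.
  by rewrite /comp; under eq_fun do rewrite EFinD; exact: integrableD.
split.
- pose F t := \int[f t]_(v in halfline) phi' v.
  have dF t : 0 < t -> is_derive t 1 F (gain p q phi' (f t) - F t).
    exact: weak_derive.
  have Fl : F t @[t --> 0^'+] --> \int[f0]_(v in halfline) phi' v.
    exact: weak_initial.
  exact: (derive_subsolution dF Fl).
- move=> t t0; apply: (dist1 _ _ _ _ _ (fH t0) mphi mphi' phiC phi'C) => v v0.
  by have := close v v0; rewrite ler_norml => /andP[]; lra.
- move=> t t0; rewrite /gain.
  have := @integrable_fst _ (f t) (fun=> e) (fH t0)
    (bounded_integrable _ (measurable_cst _) (fun _ _ => lexx `|e|)).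
  rewrite (integral_halfline_cst e (fH t0)) => -[ie <-].
  have ig := gain_integrable (f t) p0 q0 mphi phiC.
  rewrite -RintegralD//.
  apply: le_Rintegral => //.
  + exact: gain_integrable phi'C.
  + by rewrite /comp; under eq_fun do rewrite EFinD; exact: integrableD.
  + move=> z /halfline2P[z1 z2].
    have v0 : 0 <= p * z.1 + q * z.2 by rewrite addr_ge0// mulr_ge0.
    by have := close _ v0; rewrite ler_norml => /andP[]; lra.
- apply: (dist1 _ _ _ _ _ f0H mphi' mphi phi'C phiC) => v v0.
  by have := close v v0; rewrite ler_norml => /andP[]; lra.
Qed.

End weak_solutions.

(** * The equation in Fourier variables *)

Lemma normr_le1_of_sqrD {R : realType} (a b : R) : a ^+ 2 + b ^+ 2 <= 1 ->
  `|a| <= 1 /\ `|b| <= 1.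
Proof.
move=> ab; have a2 := sqr_ge0 a; have b2 := sqr_ge0 b.
by rewrite !ler_norml; split; apply/andP; split; nra.
Qed.

Section trigonometric_integrals.
Context {R : realType}.
Implicit Types (mu : proba R) (a b xi x p q : R).

Let H : set (measurableTypeR R) := @halfline R.

(** Real combinations with a^2 + b^2 <= 1 stand in for the modulus of the complex Fourier transform;
    [dot_le_sqrt] and [sqrt_le_of_dot] translate between the two. *)
Definition trig a b x : R := a * cos x + b * sin x.

Definition cos_int mu xi := \int[mu]_(v in H) cos (xi * v).
Definition sin_int mu xi := \int[mu]_(v in H) sin (xi * v).

Lemma measurable_cosM xi :
  measurable_fun [set: measurableTypeR R] (fun v => cos (xi * v)).
Proof.
apply: measurableT_comp; last exact: measurable_funM.
by apply: continuous_measurable_fun; exact: continuous_cos.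
Qed.

Lemma measurable_sinM xi :
  measurable_fun [set: measurableTypeR R] (fun v => sin (xi * v)).
Proof.
apply: measurableT_comp; last exact: measurable_funM.
by apply: continuous_measurable_fun; exact: continuous_sin.
Qed.

Lemma integrable_cos mu xi : mu.-integrable H (EFin \o (fun v => cos (xi * v))).
Proof.
apply: (@bounded_integrable _ _ _ 1) => [|v _]; first exact: measurable_cosM.
exact: cos_max.
Qed.

Lemma integrable_sin mu xi : mu.-integrable H (EFin \o (fun v => sin (xi * v))).
Proof.
apply: (@bounded_integrable _ _ _ 1) => [|v _]; first exact: measurable_sinM.
exact: sin_max.
Qed.

Lemma trig_bound a b x : `|trig a b x| <= `|a| + `|b|.
Proof.
rewrite (le_trans (ler_normD _ _))// !normrM.
by rewrite lerD// ler_piMr// ?cos_max ?sin_max.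
Qed.

Lemma measurable_trig a b xi : measurable_fun [set: R] (fun v => trig a b (xi * v)).
Proof.
by apply: measurable_funD; apply: measurable_funM => //;
  [exact: measurable_cosM|exact: measurable_sinM].
Qed.

Lemma integrable_trig mu a b xi :
  mu.-integrable H (EFin \o (fun v => trig a b (xi * v))).
Proof.
apply: bounded_integrable (measurable_trig a b xi) _ => v _.
exact: trig_bound.
Qed.

Lemma integrable_linear2 (d : measure_display) (T : measurableType d)
    (m : {measure set T -> \bar R}) (A : set T) (f g : T -> R) a b :
  measurable A -> m.-integrable A (EFin \o f) -> m.-integrable A (EFin \o g) ->
  m.-integrable A (EFin \o (fun z => a * f z + b * g z)).
Proof.
move=> mA fi gi; rewrite /comp; under eq_fun do rewrite EFinD !EFinM.
by apply: integrableD => //; exact: integrableZl.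
Qed.

Lemma Rintegral_linear2 (d : measure_display) (T : measurableType d)
    (m : {measure set T -> \bar R}) (A : set T) (f g : T -> R) a b :
  measurable A -> m.-integrable A (EFin \o f) -> m.-integrable A (EFin \o g) ->
  \int[m]_(z in A) (a * f z + b * g z) =
  a * (\int[m]_(z in A) f z) + b * \int[m]_(z in A) g z.
Proof.
move=> mA fi gi.
rewrite -!RintegralZl// RintegralD//.
  by rewrite /comp; under eq_fun do rewrite EFinM; exact: integrableZl.
by rewrite /comp; under eq_fun do rewrite EFinM; exact: integrableZl.
Qed.

Lemma trig_intE mu a b xi :
  \int[mu]_(v in H) trig a b (xi * v) = a * cos_int mu xi + b * sin_int mu xi.
Proof.
apply: Rintegral_linear2; first exact: measurable_halfline.
  exact: integrable_cos.
exact: integrable_sin.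
Qed.

Lemma trig_int_bound mu a b xi : mu (~` H) = 0%E ->
  `|a * cos_int mu xi + b * sin_int mu xi| <= `|a| + `|b|.
Proof.
move=> mu0; rewrite -trig_intE.
have mH := @measurable_halfline R.
rewrite (le_trans (le_normr_Rintegral mH (integrable_trig mu a b xi)))//.
rewrite -[leRHS](integral_halfline_cst _ mu0); apply: le_Rintegral => //.
- exact: integrable_norm (integrable_trig mu a b xi).
- by apply: (@bounded_integrable _ _ _ (`|(`|a| + `|b|)|)).
- by move=> v _; exact: trig_bound.
Qed.

(** The Fourier transform has modulus at most 1: integrate (cos - c)^2 + (sin - s)^2 >= 0, where c
    and s are the integrals themselves. *)
Lemma cos_sin_int_le1 mu xi : mu (~` H) = 0%E ->
  cos_int mu xi ^+ 2 + sin_int mu xi ^+ 2 <= 1.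
Proof.
move=> mu0; set c := cos_int mu xi; set s := sin_int mu xi.
have : \int[mu]_(v in H) trig (2 * c) (2 * s) (xi * v) <=
    \int[mu]_(v in H) (fun=> 1 + (c ^+ 2 + s ^+ 2)) v.
  apply: le_Rintegral; first exact: measurable_halfline.
  - exact: integrable_trig.
  - by apply: (@bounded_integrable _ _ _ (`|1 + (c ^+ 2 + s ^+ 2)|)).
  - move=> v _; rewrite /trig.
    have := cos2Dsin2 (xi * v); move: (cos _) (sin _) => x y xy.
    have := addr_ge0 (sqr_ge0 (x - c)) (sqr_ge0 (y - s)); lra.
rewrite integral_halfline_cst// trig_intE -/c -/s; lra.
Qed.

(** Addition formulas and Fubini: in complex form the gain is the product of the transforms at p xi
    and q xi. *)
Lemma gain_trig mu p q a b xi : mu (~` H) = 0%E ->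
  gain p q (fun v => trig a b (xi * v)) mu =
  a * (cos_int mu (p * xi) * cos_int mu (q * xi) -
       sin_int mu (p * xi) * sin_int mu (q * xi)) +
  b * (sin_int mu (p * xi) * cos_int mu (q * xi) +
       cos_int mu (p * xi) * sin_int mu (q * xi)).
Proof.
move=> mu0; have mH := @measurable_halfline R; have mH2 := @measurable_halfline2 R.
have ic x := integrable_cos mu x; have is_ x := integrable_sin mu x.
have icc := integrable_prodM mH mH (ic (p * xi)) (ic (q * xi)).
have iss := integrable_prodM mH mH (is_ (p * xi)) (is_ (q * xi)).
have isc := integrable_prodM mH mH (is_ (p * xi)) (ic (q * xi)).
have ics := integrable_prodM mH mH (ic (p * xi)) (is_ (q * xi)).
rewrite /gain (@eq_Rintegral _ _ _ _ _
  (fun z : measurableTypeR R * measurableTypeR R =>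
   a * (1 * (cos (p * xi * z.1) * cos (q * xi * z.2)) +
        -1 * (sin (p * xi * z.1) * sin (q * xi * z.2))) +
   b * (1 * (sin (p * xi * z.1) * cos (q * xi * z.2)) +
        1 * (cos (p * xi * z.1) * sin (q * xi * z.2))))); last first.
  move=> z _; rewrite /trig.
  rewrite (_ : xi * _ = p * xi * z.1 + q * xi * z.2) ?cosD ?sinD; last by ring.
  by ring.
rewrite Rintegral_linear2//; [|exact: integrable_linear2..].
rewrite !Rintegral_linear2//.
rewrite (Rintegral_prodM mH mH (ic (p * xi)) (ic (q * xi))).
rewrite (Rintegral_prodM mH mH (is_ (p * xi)) (is_ (q * xi))).
rewrite (Rintegral_prodM mH mH (is_ (p * xi)) (ic (q * xi))).
rewrite (Rintegral_prodM mH mH (ic (p * xi)) (is_ (q * xi))).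
by rewrite -!/(cos_int _ _) -!/(sin_int _ _); ring.
Qed.

End trigonometric_integrals.

Lemma measurable_expN {R : realType} (c : R) :
  measurable_fun [set: R] (fun v => expR (- (c * v))).
Proof.
apply: measurableT_comp; first exact: measurable_expR.
by apply: measurableT_comp => //; exact: measurable_funM.
Qed.

Lemma cvg_expN_harmonic {R : realType} (v : R) :
  expR (- (harmonic n * v)) @[n --> \oo] --> (1 : R).
Proof.
rewrite -expR0 -oppr0 -(mul0r v).
apply: continuous_cvg; first exact: continuous_expR.
by apply: cvgN; apply: cvgMl; exact: cvg_harmonic.
Qed.

Section real_dominated_convergence.
Context {d : measure_display} {T : measurableType d} {R : realType}.
Variables (mu : {measure set T -> \bar R}) (D : set T).
Implicit Types (f g : T -> R).

Lemma Rintegral_dominated_cvg (f_ : nat -> T -> R) f g : measurable D ->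
  (forall n, measurable_fun D (f_ n)) ->
  (forall x, D x -> f_ n x @[n --> \oo] --> f x) ->
  mu.-integrable D (EFin \o g) ->
  (forall n x, D x -> `|f_ n x| <= g x) ->
  \int[mu]_(x in D) f_ n x @[n --> \oo] --> \int[mu]_(x in D) f x.
Proof.
move=> mD mf ff ig fg; apply/fine_cvg.
have mf' n : measurable_fun D (EFin \o f_ n) by apply/measurable_EFinP.
have ff' x : D x -> (EFin \o f_ ^~ x) n @[n --> \oo] --> (f x)%:E.
  by move=> Dx; apply: cvg_EFin; [exact: nearW|exact: ff].
have fif : mu.-integrable D (EFin \o f).
  apply: (le_integrable mD _ _ ig).
    exact: (emeasurable_fun_cvg _ _ mf' ff').
  move=> x Dx /=; rewrite lee_fin (le_trans _ (ler_norm _))//.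
  by apply: (cvgr_to_le (cvg_norm (ff x Dx))); apply: nearW => n; exact: fg.
rewrite fineK; last exact: integrable_fin_num.
by apply: (dominated_cvg mD mf' ff' _ ig) => // n x Dx; rewrite /= lee_fin fg.
Qed.

End real_dominated_convergence.

(** * Moments and integrability of powers *)

Section moments.
Context {R : realType}.
Implicit Types (mu : proba R) (r s : R).

Let H : set (measurableTypeR R) := @halfline R.

(** Domination by v^r <= 1 + v^s on the half-line. *)
Lemma integrable_powR mu r s : 0 <= r <= s -> (moment s mu < +oo)%E ->
  mu.-integrable H (EFin \o (fun v => v `^ r)).
Proof.
move=> /andP[r0 rs] ms.
have i1 : mu.-integrable H (EFin \o (fun=> 1 : R)).
  by apply: (@bounded_integrable _ _ _ 1) => // v _; rewrite normr1.
have mp t : measurable_fun [set: measurableTypeR R] (fun v : R => v `^ t).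
  exact: measurable_powR.
have iS : mu.-integrable H (EFin \o (fun v => `|v| `^ s)).
  apply/integrableP; split.
    apply/measurable_EFinP; apply: measurable_funTS.
    exact: measurableT_comp (mp s) _.
  apply: le_lt_trans ms; rewrite le_eqVlt; apply/orP; left; apply/eqP.
  by apply: eq_integral => v _; rewrite /= ger0_norm ?powR_ge0.
apply: (@integrable_dominated _ _ _ (fun v => 1 * 1 + 1 * `|v| `^ s)) => //.
  exact: integrable_linear2 (measurable_halfline) i1 iS.
move=> v v0; rewrite ger0_norm ?powR_ge0// !mul1r ger0_norm//.
have [v1|/ltW v1] := leP v 1.
  rewrite (@le_trans _ _ 1) ?lerDl ?powR_ge0//.
  rewrite -[leRHS](_ : 1 `^ r = 1); last by rewrite powR1.
  by apply: ge0_ler_powR; rewrite ?nnegrE.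
by rewrite (le_trans (ler_powR v1 rs))// lerDr.
Qed.

Lemma moment_lty mu r s : 0 <= r <= s -> (moment s mu < +oo)%E ->
  (moment r mu < +oo)%E.
Proof.
move=> rs ms; have /integrableP[_] := integrable_powR rs ms.
apply: le_lt_trans; rewrite le_eqVlt; apply/orP; left; apply/eqP.
apply: eq_integral => v; rewrite inE => /halflineP v0.
by rewrite /= (ger0_norm v0) ger0_norm ?powR_ge0.
Qed.

Lemma moment_Rintegral mu s : 0 <= s -> (moment s mu < +oo)%E ->
  moment s mu = (\int[mu]_(v in H) v `^ s)%:E.
Proof.
move=> s0 ms; have mH := @measurable_halfline R.
have is_ : mu.-integrable H (EFin \o (fun v => v `^ s)).
  by apply: integrable_powR ms; rewrite s0 lexx.
rewrite /Rintegral fineK; last exact: integrable_fin_num.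
by apply: eq_integral => v; rewrite inE => /halflineP v0; rewrite ger0_norm.
Qed.

Lemma integrable_id mu s : 1 <= s -> (moment s mu < +oo)%E ->
  mu.-integrable H (EFin \o (fun v => v)).
Proof.
move=> s1 ms.
have := @integrable_powR mu 1 s; rewrite ler01 s1 => /(_ isT ms) i.
apply: integrable_dominated i _ => // v v0.
by rewrite powRr1// ger0_norm.
Qed.

End moments.

(** * The stationary equation on the Fourier side *)

Section stationary.
Context {R : realType}.
Variables (p q alpha : R) (mu : proba R).
Hypotheses (p0 : 0 <= p) (q0 : 0 <= q) (alpha1 : 1 < alpha).
Hypothesis st : stationary_solution p q alpha mu.
Implicit Types (a b xi eps : R).

Let H : set (measurableTypeR R) := @halfline R.

Let mu0 : mu (~` H) = 0%E. Proof. by case: st => -[]. Qed.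

Let int_id : mu.-integrable H (EFin \o (fun v => v)).
Proof. by case: st => -[_ ma] _ _; exact: integrable_id (ltW alpha1) ma. Qed.

(** The stationary equation is only tested with functions vanishing at infinity, so the
    trigonometric functions have to be damped first. *)
Lemma test_fun0_trig a b xi eps : 0 < eps ->
  test_fun0 (fun v => trig a b (xi * v) * expR (- (eps * v))).
Proof.
move=> e0; split.
  apply: smoothb_test => n.
  by apply: smoothbM; [exact: smoothb_trig|exact: (smoothb_expN _ (ltW e0))].
have E : (`|a| + `|b|) * expR (- (eps * v)) @[v --> +oo] --> 0.
  rewrite -[X in _ --> X](mulr0 (`|a| + `|b|)); apply: cvgMr.
  have : eps * v @[v --> +oo] --> +oo by apply: gt0_cvgMry => //; exact: cvg_id.
  move=> h; exact: (cvg_comp (fun v => eps * v) (fun v => expR (- v)) h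
    (@cvgr_expR R)).
apply: norm_cvg0.
apply: (@squeeze_cvgr _ _ _ _ (cst 0) _ _ _ _ _ E); last exact: cvg_cst.
apply: nearW => v; rewrite normr_ge0/= normrM (ger0_norm (expR_ge0 _)).
by rewrite ler_wpM2r ?expR_ge0 ?trig_bound.
Qed.

Lemma derive1_damped_trig a b xi eps v :
  derive1 (fun v => trig a b (xi * v) * expR (- (eps * v))) v =
  (xi * trig b (- a) (xi * v) - eps * trig a b (xi * v)) * expR (- (eps * v)).
Proof.
rewrite derive1E /trig; apply: derive_val.
by apply: is_derive_eq; rewrite /GRing.scale/=; ring.
Qed.

(** The damping rate 1/(n + 1) is sent to 0 by dominated convergence in each of the three integrals;
    the derivative term is dominated by a multiple of v, integrable since alpha > 1. *)
Lemma stationary_trig a b xi :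
  (p + q - 1) * (\int[mu]_(v in H) (xi * trig b (- a) (xi * v) * v)) =
  gain p q (fun v => trig a b (xi * v)) mu -
  \int[mu]_(v in H) trig a b (xi * v).
Proof.
have mH := @measurable_halfline R; have mH2 := @measurable_halfline2 R.
pose e n : R := harmonic n.
have e0 n : 0 < e n by rewrite invr_gt0.
have e1 n : e n <= 1 by rewrite invf_le1// ler1n.
pose phi n v := trig a b (xi * v) * expR (- (e n * v)).
have ecvg v : expR (- (e n * v)) @[n --> \oo] --> (1 : R).
  exact: cvg_expN_harmonic.
have phic v : phi n v @[n --> \oo] --> trig a b (xi * v).
  by rewrite -[X in _ --> X]mulr1; apply: cvgMr.
have exp1 n v : 0 <= v -> expR (- (e n * v)) <= 1.
  by move=> v0; rewrite -expR0 ler_expR oppr_le0 mulr_ge0// ltW.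
have phib n v : 0 <= v -> `|phi n v| <= `|a| + `|b|.
  move=> v0; rewrite normrM (ger0_norm (expR_ge0 _)).
  by rewrite -[leRHS]mulr1 ler_pM ?expR_ge0 ?trig_bound ?exp1.
have mphi n : measurable_fun [set: R] (phi n).
  by apply: measurable_funM; [exact: measurable_trig|exact: measurable_expN].
have icst (m := `|a| + `|b|) : mu.-integrable H (EFin \o (fun=> m)).
  by apply: (@bounded_integrable _ _ _ `|m|).
have c1 : \int[mu]_(v in H) phi n v @[n --> \oo] --> \int[mu]_(v in H) trig a b (xi * v).
  apply: (Rintegral_dominated_cvg mH _ _ icst).
  - by move=> n; apply: measurable_funTS; exact: mphi.
  - by move=> v _; exact: phic.
  - by move=> n v /halflineP; exact: phib.
have c2 : gain p q (phi n) mu @[n --> \oo] --> gain p q (fun v => trig a b (xi * v)) mu.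
  have [icst2 _] := integrable_fst mu0 icst.
  apply: (Rintegral_dominated_cvg mH2 _ _ icst2).
  - by move=> n; apply: measurable_funTS; exact: measurable_affine2.
  - by move=> v _; exact: phic.
  - by move=> n z /halfline2P[z1 z2]; apply: phib; rewrite addr_ge0// mulr_ge0.
have c3 : \int[mu]_(v in H) (derive1 (phi n) v * v) @[n --> \oo] -->
    \int[mu]_(v in H) (xi * trig b (- a) (xi * v) * v).
  (* The two terms of the derivative contribute [|xi|] and the damping rate, which is at most 1. *)
  pose M := (`|xi| + 1) * (`|a| + `|b|).
  have iM : mu.-integrable H (EFin \o (fun v => M * v + 0 * v)).
    exact: integrable_linear2.
  apply: (Rintegral_dominated_cvg mH _ _ iM).
  - move=> n; apply: measurable_funTS; apply: measurable_funM => //.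
    have -> : derive1 (phi n) = fun v => (xi * trig b (- a) (xi * v) -
        e n * trig a b (xi * v)) * expR (- (e n * v)).
      by apply/funext => v; exact: derive1_damped_trig.
    apply: measurable_funM; last exact: measurable_expN.
    by apply: measurable_funB; apply: measurable_funM => //; exact: measurable_trig.
  - move=> v _.
    have ee : e n * trig a b (xi * v) @[n --> \oo] --> 0 * trig a b (xi * v).
      by apply: cvgMl; exact: cvg_harmonic.
    have dd : (xi * trig b (- a) (xi * v) - e n * trig a b (xi * v)) *
        expR (- (e n * v)) * v @[n --> \oo] -->
        (xi * trig b (- a) (xi * v) - 0 * trig a b (xi * v)) * 1 * v.
      apply: cvgM; last exact: cvg_cst.
      by apply: cvgM => //; apply: cvgB => //; exact: cvg_cst.
    rewrite mul0r subr0 mulr1 in dd.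
    apply: cvg_trans dd; apply: near_eq_cvg; apply: nearW => n.
    by rewrite derive1_damped_trig.
  - move=> n v /halflineP v0; rewrite mul0r addr0 normrM (ger0_norm v0) ler_wpM2r//.
    rewrite derive1_damped_trig normrM (ger0_norm (expR_ge0 _)).
    rewrite -[leRHS]mulr1 ler_pM ?expR_ge0 ?exp1//.
    rewrite (le_trans (ler_normB _ _))// /M mulrDl !normrM (ger0_norm (ltW (e0 n))).
    apply: lerD; rewrite ler_pM ?(ltW (e0 n)) ?trig_bound//.
    by rewrite (le_trans (trig_bound _ _ _))// normrN addrC.
have E n : (p + q - 1) * (\int[mu]_(v in H) (derive1 (phi n) v * v)) =
    gain p q (phi n) mu - \int[mu]_(v in H) phi n v.
  rewrite -(collisionE p0 q0 mu0 (mphi n) (phib n)).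
  by case: st => _ _; apply; exact: test_fun0_trig.
have L : (p + q - 1) * (\int[mu]_(v in H) (derive1 (phi n) v * v)) @[n --> \oo] -->
    (p + q - 1) * (\int[mu]_(v in H) (xi * trig b (- a) (xi * v) * v)).
  exact: cvgMr.
have L' : (p + q - 1) * (\int[mu]_(v in H) (derive1 (phi n) v * v)) @[n --> \oo] -->
    gain p q (fun v => trig a b (xi * v)) mu - \int[mu]_(v in H) trig a b (xi * v).
  by under eq_fun do rewrite E; exact: cvgB.
by rewrite -(cvg_lim (@Rhausdorff R) L) (cvg_lim (@Rhausdorff R) L').
Qed.

(** Differentiation under the integral sign, with a majorant proportional to v; the mean of [mu] is
    finite because alpha > 1. *)
Lemma derive_trig_int a b xi :
  is_derive xi 1 (fun xi => \int[mu]_(v in H) trig a b (xi * v))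
    (\int[mu]_(v in H) (trig b (- a) (xi * v) * v)).
Proof.
have mH := @measurable_halfline R.
pose F xi v := trig a b (xi * v).
have dF (x v : R) : is_derive x 1 (F ^~ v) (trig b (- a) (x * v) * v).
  by rewrite /F /trig; apply: is_derive_eq; rewrite /GRing.scale/=; ring.
have dFE x v : partial1of2 F x v = trig b (- a) (x * v) * v.
  by rewrite partial1of2E; exact: derive_val.
pose G (v : R) := (`|a| + `|b|) * `|v|.
have iG : mu.-integrable H (EFin \o G).
  apply: eq_integrable (integrable_linear2 (`|a| + `|b|) 0 mH int_id int_id) => //.
  move=> v; rewrite inE => /halflineP v0.
  by rewrite /= /G mul0r addr0 (ger0_norm v0).
have xiI : `]xi - 1, xi + 1[%classic xi.
  by rewrite /= in_itv/= ltrBlDr ltrDl ltr01.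
have iF x : `]xi - 1, xi + 1[%classic x -> mu.-integrable H (EFin \o F x).
  by move=> _; exact: integrable_trig.
have dF' x v : `]xi - 1, xi + 1[%classic x -> H v -> derivable (F ^~ v) x 1.
  by move=> _ _; exact: ex_derive.
have G0 v : 0 <= G v by rewrite mulr_ge0.
have FG x v : `]xi - 1, xi + 1[%classic x -> H v -> `|partial1of2 F x v| <= G v.
  move=> _ _; rewrite dFE normrM ler_wpM2r// (le_trans (trig_bound _ _ _))//.
  by rewrite normrN addrC.
apply: DeriveDef.
  exact: (derivable_under_integral mH xiI iF dF' G0 iG FG).
rewrite -derive1E (differentiation_under_integral mH xiI iF dF' G0 iG FG).
by apply: eq_Rintegral => v _; exact: dFE.
Qed.

(* The Fourier side of the self-similar solution generated by mu of the unscaled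
   equation. *)
Lemma derive_stationary_trig a b xi (t : R) :
  is_derive t 1
    (fun t => \int[mu]_(v in H) trig a b (expR ((p + q - 1) * t) * xi * v))
    (gain p q (fun v => trig a b (expR ((p + q - 1) * t) * xi * v)) mu -
     \int[mu]_(v in H) trig a b (expR ((p + q - 1) * t) * xi * v)).
Proof.
rewrite -stationary_trig.
pose x t := expR ((p + q - 1) * t) * xi.
have dx : is_derive t 1 x ((p + q - 1) * x t).
  by apply: is_derive_eq; rewrite /GRing.scale/= /x; ring.
have := is_derive1_comp (derive_trig_int a b (x t)) dx => h.
apply: (is_derive_eq h); rewrite mulrCA; congr (_ * _).
rewrite mulrC -RintegralZl; last 2 first.
- exact: measurable_halfline.
- apply: integrable_dominated
    (integrable_linear2 (`|a| + `|b|) 0 (@measurable_halfline R) int_id int_id) _.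
    by apply: measurable_funM => //; exact: measurable_trig.
  move=> v v0; rewrite mul0r addr0 normrM (ger0_norm v0) ler_wpM2r//.
  by rewrite (le_trans (trig_bound _ _ _))// normrN addrC.
by apply: eq_Rintegral => v _; rewrite mulrA.
Qed.

End stationary.

(** * Comparison with the self-similar solution *)

Section Fourier_comparison.
Context {R : realType}.
Variables (p q alpha : R) (f0 ginf : proba R) (f : R -> proba R).
Hypotheses (p0 : 0 <= p) (q0 : 0 <= q) (alpha1 : 1 < alpha).
Hypothesis ws : weak_solution p q alpha f0 f.
Hypothesis st : stationary_solution p q alpha ginf.
Implicit Types (a b xi t r D S : R).

Let H : set (measurableTypeR R) := @halfline R.

Let fH t : 0 < t -> f t (~` H) = 0%E.
Proof. by move=> t0; case: ws => _ /(_ t t0)[]. Qed.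

Let gH : ginf (~` H) = 0%E. Proof. by case: st => -[]. Qed.

Let m t := expR ((p + q - 1) * t).

(** The steady state is dilated by the explicit factor [m t]; that this is the mean of [f t] is not
    yet known and will be deduced from the resulting estimate. *)
Definition trig_diff a b xi t :=
  \int[f t]_(v in H) trig a b (xi * v) -
  \int[ginf]_(v in H) trig a b (m t * xi * v).

Lemma trig_diff_subsolution a b xi : subsolution (trig_diff a b xi)
  (fun t => gain p q (fun v => trig a b (xi * v)) (f t) -
            gain p q (fun v => trig a b (m t * xi * v)) ginf)
  (\int[f0]_(v in H) trig a b (xi * v) - \int[ginf]_(v in H) trig a b (xi * v)).
Proof.
have tt : test_fun (fun v => trig a b (xi * v)).
  by apply: smoothb_test => n; exact: smoothb_trig.
have dG t := derive_stationary_trig p0 q0 alpha1 st a b xi t.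
apply: derive_subsolution => [t t0|].
  have dF := weak_derive p0 q0 ws tt t0.
  apply: (is_derive_eq (is_deriveB dF (dG t))).
  by rewrite /trig_diff -/(m t); ring.
apply: cvgB; first exact: (weak_initial ws tt).
have /cvg_at_right_filter : {for 0,
    continuous (fun t => \int[ginf]_(v in H) trig a b (m t * xi * v))}.
  apply: differentiable_continuous; apply/derivable1_diffP.
  exact: (@ex_derive _ _ _ _ _ _ _ (dG 0)).
by rewrite /m mulr0 expR0 mul1r.
Qed.

Lemma trig_diff_le r D : 0 <= D ->
  (forall a b xi, a ^+ 2 + b ^+ 2 <= 1 ->
     \int[f0]_(v in H) trig a b (xi * v) - \int[ginf]_(v in H) trig a b (xi * v)
       <= D * `|xi| `^ r) ->
  forall a b xi t, a ^+ 2 + b ^+ 2 <= 1 -> 0 < t ->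
    trig_diff a b xi t <= D * `|xi| `^ r * expR ((p `^ r + q `^ r - 1) * t).
Proof.
move=> D0 init a b xi t ab t0.
(* The comparison runs over all frequencies and over the whole unit disc of coefficients at once,
   since the gain mixes both. *)
pose I := {i : R * R * R | i.1.1 ^+ 2 + i.1.2 ^+ 2 <= 1}.
pose K := p `^ r + q `^ r - 1.
pose Y (i : I) t := D * `|(val i).2| `^ r * expR (K * t).
pose dY (i : I) t := D * `|(val i).2| `^ r * (K * expR (K * t)).
pose U (i : I) := trig_diff (val i).1.1 (val i).1.2 (val i).2.
have Y0 i s : 0 <= Y i s by rewrite !mulr_ge0 ?powR_ge0 ?expR_ge0.
suff: forall (i : I) s, 0 < s -> U i s <= Y i s.
  by move=> /(_ (exist _ (a, b, xi) ab) t t0).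
have sub (i : I) := @trig_diff_subsolution (val i).1.1 (val i).1.2 (val i).2.
(* 4 bounds the difference of two integrals, each at most |a| + |b| <= 2. With K = 3 the allowed
   error factor (K + 1)/2 is 2, one unit for each of the frequencies p xi and q xi. *)
apply: (@comparison _ I U _ Y dY _ 3 4 sub) => //.
- move=> i s; rewrite /Y /dY.
  by apply: is_derive_eq; rewrite /GRing.scale/=; ring.
- by move=> [[[a' b'] xi'] /= ab']; rewrite /Y /= mulr0 expR0 mulr1; exact: init.
- move=> [[[a' b'] xi'] /= ab'] s s0.
  rewrite -[leLHS]add0r lerD// /U /= /trig_diff !trig_intE.
  have [a1 b1] := normr_le1_of_sqrD ab'.
  have := trig_int_bound a' b' xi' (fH s0).
  have := trig_int_bound a' b' (m s * xi') gH.
  by rewrite !ler_norml => /andP[h1 h2] /andP[h3 h4]; lra.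
move=> S S0 HS [[[a' b'] xi'] /= ab'] s s0.
rewrite !gain_trig//; last exact: fH.
have HS' a1 b1 x1 : a1 ^+ 2 + b1 ^+ 2 <= 1 ->
   a1 * (cos_int (f s) x1 - cos_int ginf (m s * x1)) +
   b1 * (sin_int (f s) x1 - sin_int ginf (m s * x1)) <=
   D * `|x1| `^ r * expR (K * s) + S * expR (3 * s).
  move=> ab1; have := HS (exist _ (a1, b1, x1) ab1) s s0.
  by rewrite /U /Y /= /trig_diff !trig_intE; lra.
have cs_f x := cos_sin_int_le1 x (fH s0); have cs_g x := cos_sin_int_le1 x gH.
have E x c : x * (m s * c) = m s * (x * c) by ring.
rewrite !E.
(* With A, B the two transforms, A(p)A(q) - B(p)B(q) = (A - B)(p) A(q) + B(p) (A - B)(q).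
   Multiplying by A(q) or B(p), of modulus at most 1, turns (a', b') into another pair in the unit
   disc. *)
have rot (x y : R) : x ^+ 2 + y ^+ 2 <= 1 ->
    (a' * x + b' * y) ^+ 2 + (b' * x - a' * y) ^+ 2 <= 1.
  move=> xy.
  rewrite (_ : _ + _ = (a' ^+ 2 + b' ^+ 2) * (x ^+ 2 + y ^+ 2)); last by ring.
  by rewrite -[leRHS]mulr1 ler_pM ?addr_ge0 ?sqr_ge0.
have h1 := HS' _ _ (p * xi') (rot _ _ (cs_f (q * xi'))).
have h2 := HS' _ _ (q * xi') (rot _ _ (cs_g (m s * (p * xi')))).
rewrite !normrM !powRM// !(ger0_norm p0) !(ger0_norm q0) in h1 h2.
move: (lerD h1 h2); congr (is_true (_ <= _)); first by ring.
by rewrite /Y /dY /= -[K in RHS]/(p `^ r + q `^ r - 1); field.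
Qed.

End Fourier_comparison.

(** * Taylor bounds and growth of the mean *)

Section Taylor.
Context {R : realType}.
Implicit Types (a b x xi r s C : R) (mu nu : proba R).

Let H : set (measurableTypeR R) := @halfline R.

Lemma ge0_of_derive (g dg : R -> R) : (forall x, is_derive x 1 g (dg x)) ->
  g 0 = 0 -> (forall x, 0 <= x -> 0 <= dg x) -> forall x, 0 <= x -> 0 <= g x.
Proof.
move=> dgE g0 dg0 x x0; rewrite -g0.
apply: (@ger0_derive1_le_cc _ g 0 x); rewrite ?in_itv/= ?lexx ?x0//.
- move=> y; rewrite in_itv/= => /andP[y0 _].
  by rewrite derive1E (@derive_val _ _ _ _ _ _ _ (dgE y)) dg0// ltW.
- apply: derivable_within_continuous => y _.
  exact: (@ex_derive _ _ _ _ _ _ _ (dgE y)).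
Qed.

Lemma sin_le x : 0 <= x -> sin x <= x.
Proof.
move=> x0; rewrite -subr_ge0.
apply: (@ge0_of_derive (fun x => x - sin x) (fun x => 1 - cos x)) x0.
- by rewrite sin0 subrr.
- by move=> y _; rewrite subr_ge0 cos_le1.
Qed.

Lemma sin_abs_le x : 0 <= x -> `|sin x| <= x.
Proof.
move=> x0; rewrite ler_norml sin_le// andbT -subr_ge0 opprK.
apply: (@ge0_of_derive (fun x => sin x + x) (fun x => cos x + 1)) x0.
- by rewrite sin0 addr0.
- by move=> y _; have := cos_geN1 y; lra.
Qed.

Lemma oneBcosE x : 1 - cos x = 2 * sin (x / 2) ^+ 2.
Proof.
have {1}-> : x = (x / 2) *+ 2 by rewrite -mulr_natr divfK.
rewrite cos_mulr2n; have := cos2Dsin2 (x / 2); rewrite !mulr2n; lra.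
Qed.

Lemma oneBcos_le_sqr x : 0 <= x -> 1 - cos x <= x ^+ 2.
Proof.
move=> x0; rewrite oneBcosE.
have x20 : 0 <= x / 2 by rewrite divr_ge0.
have := sin_abs_le x20; rewrite ler_norml => /andP[]; nra.
Qed.

Lemma oneBcos_le x : 0 <= x -> 1 - cos x <= 2 * x.
Proof.
move=> x0; rewrite -subr_ge0.
apply: (@ge0_of_derive (fun x => 2 * x - (1 - cos x)) (fun x => 2 - sin x)) x0.
- by move=> y; apply: is_derive_eq; rewrite /GRing.scale/=; ring.
- by rewrite cos0; ring.
- by move=> y _; have := sin_le1 y; lra.
Qed.

Lemma subr_sin_le_sqr x : 0 <= x -> x - sin x <= x ^+ 2.
Proof.
move=> x0; rewrite -subr_ge0.
apply: (@ge0_of_derive (fun x => x ^+ 2 - (x - sin x))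
  (fun x => 2 * x - (1 - cos x))) x0.
- by move=> y; apply: is_derive_eq; rewrite /GRing.scale/=; ring.
- by rewrite sin0; ring.
- by move=> y y0; rewrite subr_ge0 oneBcos_le.
Qed.

(** For x <= 1 the quadratic bounds and x^2 <= x^r; for x >= 1 the trivial bounds and x <= x^r. *)
Lemma cos_sin_taylor x r : 1 <= r <= 2 -> 0 <= x ->
  `|cos x - 1| <= 2 * x `^ r /\ `|sin x - x| <= 2 * x `^ r.
Proof.
move=> /andP[r1 r2]; rewrite le_eqVlt => /predU1P[<-|x0].
  by rewrite cos0 sin0 !subrr normr0 mulr_ge0 ?powR_ge0.
have x0' := ltW x0.
rewrite [X in X <= _ /\ _]distrC [X in _ /\ X <= _]distrC.
rewrite !ger0_norm ?subr_ge0 ?cos_le1 ?sin_le//.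
have [x1|/ltW x1] := leP x 1.
  have xr : x ^+ 2 <= x `^ r.
    rewrite -powR_mulrn//; apply: ger_powR => //; rewrite x0//.
  by have := oneBcos_le_sqr x0'; have := subr_sin_le_sqr x0'; split; nra.
have xr := le1r_powR x1 r1.
have := sin_abs_le x0'; rewrite ler_norml => /andP[+ _].
by have := cos_geN1 x; have := sin_geN1 x; split; lra.
Qed.

Lemma trig_taylor a b x r : 1 <= r <= 2 -> a ^+ 2 + b ^+ 2 <= 1 ->
  `|trig a b x - (a + b * x)| <= 4 * `|x| `^ r.
Proof.
move=> r12 ab.
wlog x0 : x b ab / 0 <= x.
  move=> W; have [x0|/ltW x0] := leP 0 x; first exact: W.
  have := W (- x) (- b); rewrite sqrrN oppr_ge0 normrN /trig cosN sinN !mulrNN.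
  exact.
have [a1 b1] := normr_le1_of_sqrD ab.
have [h1 h2] := cos_sin_taylor r12 x0; rewrite (ger0_norm x0).
rewrite /trig (_ : _ - _ = a * (cos x - 1) + b * (sin x - x)); last by ring.
rewrite (le_trans (ler_normD _ _))// !normrM.
rewrite (_ : 4 * _ = 1 * (2 * x `^ r) + 1 * (2 * x `^ r)); last by ring.
by rewrite lerD// ler_pM.
Qed.

Lemma trig_int_taylor mu a b xi r : mu (~` H) = 0%E -> 1 <= r <= 2 ->
  (moment r mu < +oo)%E -> a ^+ 2 + b ^+ 2 <= 1 ->
  `|\int[mu]_(v in H) trig a b (xi * v) - (a + b * xi * mean mu)| <=
  4 * (\int[mu]_(v in H) v `^ r) * `|xi| `^ r.
Proof.
move=> mu0 r12 mr ab; have /andP[r1 r2] := r12.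
have mH := @measurable_halfline R.
have r0 : 0 <= r by rewrite (le_trans _ r1).
have ir : mu.-integrable H (EFin \o (fun v => v `^ r)).
  by apply: integrable_powR mr; rewrite r0 lexx.
have iid := integrable_id r1 mr.
have i1 : mu.-integrable H (EFin \o (fun=> 1 : R)).
  by apply: (@bounded_integrable _ _ _ 1) => // v _; rewrite normr1.
have iaff := integrable_linear2 a (b * xi) mH i1 iid.
have iT := integrable_trig mu a b xi.
have -> : a + b * xi * mean mu = \int[mu]_(v in H) (a * 1 + b * xi * v).
  rewrite Rintegral_linear2// /mean.
  by rewrite (integral_halfline_cst 1 mu0) mulr1.
rewrite -RintegralB//.
have id : mu.-integrable H (EFin \o (fun v => trig a b (xi * v) - (a * 1 + b * xi * v))).
  by rewrite /comp; under eq_fun do rewrite EFinB; exact: integrableB.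
rewrite (le_trans (le_normr_Rintegral mH id))//.
rewrite [leRHS]mulrAC -RintegralZl//.
apply: le_Rintegral => //.
- exact: integrable_norm id.
- by rewrite /comp; under eq_fun do rewrite EFinM; exact: integrableZl.
- move=> v /halflineP v0; rewrite mulr1 -(mulrA b).
  rewrite (le_trans (trig_taylor _ r12 ab))// normrM powRM// (ger0_norm v0).
  by rewrite mulrA.
Qed.

(** Equal mass and mean cancel the affine Taylor parts, leaving two remainders of order r. *)
Lemma trig_int_diff_le mu nu r : mu (~` H) = 0%E -> nu (~` H) = 0%E ->
  1 <= r <= 2 -> (moment r mu < +oo)%E -> (moment r nu < +oo)%E ->
  mean mu = mean nu -> forall a b xi, a ^+ 2 + b ^+ 2 <= 1 ->
  \int[mu]_(v in H) trig a b (xi * v) - \int[nu]_(v in H) trig a b (xi * v) <=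
  4 * (\int[mu]_(v in H) v `^ r + \int[nu]_(v in H) v `^ r) * `|xi| `^ r.
Proof.
move=> mu0 nu0 r12 mr nr mean_eq a b xi ab.
have := trig_int_taylor xi mu0 r12 mr ab.
have := trig_int_taylor xi nu0 r12 nr ab.
rewrite mean_eq !ler_norml => /andP[h1 h2] /andP[h3 h4]; lra.
Qed.

Lemma superlinear_le0 r C x : 1 < r ->
  (forall xi, 0 < xi -> xi * x <= C * xi `^ r) -> x <= 0.
Proof.
move=> r1 h; rewrite leNgt; apply/negP => x0.
have r0 : 0 < r - 1 by rewrite subr_gt0.
have C1 : 0 < `|C| + 1 by rewrite ltr_wpDl.
(* Taking xi^(r-1) equal to this value makes C xi^r at most xi x/2, which contradicts the hypothesis
   if x > 0. *)
pose y := x / (2 * (`|C| + 1)).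
have y0 : 0 < y by rewrite divr_gt0// mulr_gt0.
pose xi := y `^ (r - 1)^-1; have xi0 : 0 < xi by rewrite powR_gt0.
have := h _ xi0.
rewrite -(mulr_powRB1 (ltW xi0) (lt_trans ltr01 r1)) mulrCA ler_pM2l//.
rewrite /xi -powRrM mulVf ?gt_eqF// powRr1 ?(ltW y0)//.
apply/negP; rewrite -ltNge.
rewrite (@le_lt_trans _ _ ((`|C| + 1) * y))//.
  by rewrite ler_wpM2r ?(ltW y0)// (le_trans (ler_norm _))// lerDl.
rewrite (_ : _ * y = x / 2); last by rewrite /y; field; rewrite gt_eqF.
by rewrite ltr_pdivrMr// ltr_pMr// ltr1n.
Qed.

End Taylor.

(** * Growth of the mean *)

Section mean_growth.
Context {R : realType}.
Variables (p q alpha : R) (f0 ginf : proba R) (f : R -> proba R).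
Hypotheses (p0 : 0 <= p) (q0 : 0 <= q) (alpha1 : 1 < alpha).
Hypothesis ws : weak_solution p q alpha f0 f.
Hypothesis st : stationary_solution p q alpha ginf.
Hypothesis mean0 : mean f0 = 1.

(** The function v is unbounded and cannot be inserted into the weak equation; the mean is instead
    read off from the first-order behaviour of the Fourier transform at 0. *)
Lemma mean_weak_solution (t : R) : 0 < t -> mean (f t) = expR ((p + q - 1) * t).
Proof.
move=> t0.
(* At most alpha for the moments to be finite, at most 2 for the first-order Taylor bound, and above
   1 so that the remainder is superlinear. *)
pose r := Num.min alpha 2.
have r1 : 1 < r by rewrite lt_min alpha1 ltr1n.
have r12 : 1 <= r <= 2 by rewrite (ltW r1) ge_min lexx orbT.
have ra : 0 <= r <= alpha by rewrite ge_min lexx (le_trans ler01 (ltW r1)).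
have mr (mu : proba R) := @moment_lty _ mu _ _ ra.
have [f0H f0a] : in_M alpha f0 by case: ws.
have [gH ga] : in_M alpha ginf by case: st.
have [ftH fta] : in_M alpha (f t) by case: ws => _ /(_ t t0).
have meang : mean ginf = 1 by case: st.
set D := 4 * (\int[f0]_(v in halfline) v `^ r + \int[ginf]_(v in halfline) v `^ r).
have D0 : 0 <= D.
  by rewrite mulr_ge0// addr_ge0// Rintegral_ge0// => v _; exact: powR_ge0.
have init : forall a b xi, a ^+ 2 + b ^+ 2 <= 1 ->
     \int[f0]_(v in halfline) trig a b (xi * v) -
     \int[ginf]_(v in halfline) trig a b (xi * v) <= D * `|xi| `^ r.
  by apply: trig_int_diff_le => //; [exact: mr|exact: mr|rewrite mean0].
have main := trig_diff_le p0 q0 alpha1 ws st D0 init.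
set m := expR _.
(* With a = 0 the sine integral isolates the linear coefficient; b = 1 and b = -1 give the two
   inequalities. *)
have key (b : R) : b ^+ 2 = 1 -> b * (mean (f t) - m) <= 0.
  move=> b2; have ab : 0 ^+ 2 + b ^+ 2 <= 1 by rewrite b2 expr0n add0r.
  apply: (superlinear_le0 r1 (C := D * expR ((p `^ r + q `^ r - 1) * t) +
    4 * (\int[f t]_(v in halfline) v `^ r) +
    4 * (\int[ginf]_(v in halfline) v `^ r) * m `^ r)) => xi xi0.
  have := main 0 b xi t ab t0; rewrite /trig_diff -/m.
  have := trig_int_taylor xi ftH r12 (mr _ fta) ab.
  have := trig_int_taylor (m * xi) gH r12 (mr _ ga) ab.
  rewrite meang normrM powRM// (gtr0_norm xi0) (ger0_norm (expR_ge0 _)) -/m.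
  by rewrite !ler_norml => /andP[h1 h2] /andP[h3 h4] h5; lra.
have h1 := key 1 (expr1n _ _).
have h2 : -1 * (mean (f t) - m) <= 0 by apply: key; rewrite sqrrN expr1n.
by apply/eqP; rewrite eq_le; apply/andP; split; lra.
Qed.

End mean_growth.

(** * Fourier distance and rescaling *)

Section Fourier_distance.
Context {R : realType}.
Implicit Types (mu nu : proba R) (a b xi s D : R).

Let H : set (measurableTypeR R) := @halfline R.

(** [fourier] integrates over the whole line, everything else over the half-line; the complement is
    negligible. *)
Lemma Rintegral_halfline mu (phi : R -> R) C : mu (~` H) = 0%E ->
  measurable_fun [set: R] phi -> (forall v, `|phi v| <= C) ->
  \int[mu]_v phi v = \int[mu]_(v in H) phi v.
Proof.
move=> mu0 mphi phiC; have mH := @measurable_halfline R.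
have ip : mu.-integrable setT (EFin \o phi).
  apply: measurable_bounded_integrable => //.
    by rewrite (le_lt_trans (probability_le1 _ measurableT)) ?ltry.
  exists C; split; first exact: num_real.
  by move=> M CM v _; apply: (le_trans (phiC v)); exact: ltW.
rewrite /Rintegral (negligible_integral (measurableC mH) measurableT ip mu0).
by rewrite setDE setCK setTI.
Qed.

Lemma fourierE mu xi : mu (~` H) = 0%E ->
  fourier mu xi = Complex (cos_int mu xi) (- sin_int mu xi).
Proof.
move=> mu0; rewrite /fourier.
rewrite (Rintegral_halfline (C := 1) mu0);
  [|exact: measurable_cosM|by move=> v; exact: cos_max].
by rewrite (Rintegral_halfline (C := 1) mu0) //;
  [exact: measurable_sinM|move=> v; exact: sin_max].
Qed.

Lemma dot_le_sqrt (a b x y : R) : a ^+ 2 + b ^+ 2 <= 1 ->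
  a * x + b * y <= Num.sqrt (x ^+ 2 + y ^+ 2).
Proof.
move=> ab; have [ax|ax] := leP (a * x + b * y) 0.
  by rewrite (le_trans ax) ?sqrtr_ge0.
rewrite -(ger0_norm (ltW ax)) -sqrtr_sqr ler_wsqrtr//.
have h : (a * x + b * y) ^+ 2 <= (a ^+ 2 + b ^+ 2) * (x ^+ 2 + y ^+ 2).
  rewrite -subr_ge0 (_ : _ - _ = (a * y - b * x) ^+ 2) ?sqr_ge0//; ring.
by rewrite (le_trans h)// ler_piMl// addr_ge0 ?sqr_ge0.
Qed.

(** Duality: the Euclidean norm is attained at the unit vector (x/N, y/N). *)
Lemma sqrt_le_of_dot (x y D : R) : 0 <= D ->
  (forall a b, a ^+ 2 + b ^+ 2 <= 1 -> a * x + b * y <= D) ->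
  Num.sqrt (x ^+ 2 + y ^+ 2) <= D.
Proof.
move=> D0 h; set N := Num.sqrt _.
have N2 : N ^+ 2 = x ^+ 2 + y ^+ 2 by rewrite sqr_sqrtr// addr_ge0 ?sqr_ge0.
have [N0|N0] := leP N 0; first exact: le_trans N0 D0.
have := h (x / N) (y / N).
have -> : (x / N) ^+ 2 + (y / N) ^+ 2 = 1.
  by rewrite !exprMn -mulrDl -N2 -exprMn mulfV ?gt_eqF// expr1n.
move=> /(_ (lexx _)); rewrite (_ : _ + _ = N)//.
have -> : x / N * x + y / N * y = (x ^+ 2 + y ^+ 2) / N by ring.
by rewrite -N2 expr2 mulfK ?gt_eqF.
Qed.

Lemma normc_fourierB mu nu xi : mu (~` H) = 0%E -> nu (~` H) = 0%E ->
  Normc.normc (fourier mu xi - fourier nu xi) =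
  Num.sqrt ((cos_int mu xi - cos_int nu xi) ^+ 2 +
            (sin_int mu xi - sin_int nu xi) ^+ 2).
Proof.
by move=> mu0 nu0; rewrite !fourierE//= -opprD sqrrN.
Qed.

Lemma fourier_dist_ge0 s mu nu : (0 <= fourier_dist s mu nu)%E.
Proof.
apply: (@le_trans _ _ (Normc.normc (fourier mu 1 - fourier nu 1) / `|1 : R| `^ s)%:E).
  rewrite lee_fin divr_ge0 ?powR_ge0//.
  by case: (_ - _) => x y; exact: sqrtr_ge0.
by apply: ereal_sup_ubound; exists 1; rewrite //= oner_eq0.
Qed.

Lemma fourier_dist_le mu nu s D : mu (~` H) = 0%E -> nu (~` H) = 0%E ->
  0 <= D ->
  (forall a b xi, a ^+ 2 + b ^+ 2 <= 1 -> xi != 0 ->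
     \int[mu]_(v in H) trig a b (xi * v) - \int[nu]_(v in H) trig a b (xi * v)
       <= D * `|xi| `^ s) ->
  (fourier_dist s mu nu <= D%:E)%E.
Proof.
move=> mu0 nu0 D0 h; apply: ge_ereal_sup => _ [xi xi0 <-].
have x0 : 0 < `|xi| `^ s by rewrite powR_gt0// normr_gt0.
rewrite lee_fin ler_pdivrMr// normc_fourierB//.
apply: sqrt_le_of_dot => [|a b ab]; first by rewrite mulr_ge0// ltW.
by have := h a b xi ab xi0; rewrite !trig_intE; lra.
Qed.

Lemma trig_diff_le_fourier_dist mu nu s D : mu (~` H) = 0%E -> nu (~` H) = 0%E ->
  0 <= D -> (fourier_dist s mu nu <= D%:E)%E ->
  forall a b xi, a ^+ 2 + b ^+ 2 <= 1 ->
  \int[mu]_(v in H) trig a b (xi * v) - \int[nu]_(v in H) trig a b (xi * v)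
    <= D * `|xi| `^ s.
Proof.
move=> mu0 nu0 D0 dD a b xi ab.
(* Frequency 0 is excluded from the supremum; there both integrals equal [a] and the difference
   vanishes. *)
have [->|xi0] := eqVneq xi 0.
  have E (m : proba R) : m (~` H) = 0%E -> \int[m]_(v in H) trig a b (0 * v) = a.
    move=> m0; rewrite -[RHS](integral_halfline_cst _ m0); apply: eq_Rintegral => v _.
    by rewrite /trig mul0r cos0 sin0 mulr1 mulr0 addr0.
  by rewrite !E// subrr mulr_ge0 ?powR_ge0.
have x0 : 0 < `|xi| `^ s by rewrite powR_gt0// normr_gt0.
have : (Normc.normc (fourier mu xi - fourier nu xi) / `|xi| `^ s <= D)%R.
  rewrite -lee_fin (le_trans _ dD)//; apply: ereal_sup_ubound.
  by exists xi.
rewrite ler_pdivrMr// normc_fourierB//; apply: le_trans.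
rewrite !trig_intE; apply: le_trans (dot_le_sqrt _ _ ab).
by rewrite le_eqVlt; apply/orP; left; apply/eqP; ring.
Qed.

End Fourier_distance.

(** * Effect of a dilation on integrals and moments *)

Section rescaling.
Context {R : realType}.
Variables (mu nu : proba R) (m : R).
Hypothesis m0 : 0 < m.
Hypothesis nuE : forall A : set (measurableTypeR R), measurable A ->
  nu A = pushforward mu (fun v : measurableTypeR R => (v / m : measurableTypeR R)) A.

Let H : set (measurableTypeR R) := @halfline R.

Let T (v : measurableTypeR R) : measurableTypeR R := v / m.

Let mT : measurable_fun setT T.
Proof. exact: measurable_funM. Qed.

Let TH : T @^-1` H = H.
Proof.
apply/seteqP; split=> v /halflineP v0; apply/halflineP.
  by move: v0; rewrite /T pmulr_lge0// invr_gt0.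
by rewrite /T divr_ge0// ltW.
Qed.

Lemma rescaled_halfline : mu (~` H) = 0%E -> nu (~` H) = 0%E.
Proof.
move=> mu0; rewrite nuE; last exact: measurableC (@measurable_halfline R).
by rewrite /pushforward -/T -preimage_setC TH.
Qed.

Lemma rescaled_Rintegral (phi : R -> R) : measurable_fun [set: R] phi ->
  mu.-integrable H (EFin \o (fun v => phi (v / m))) ->
  \int[nu]_(v in H) phi v = \int[mu]_(v in H) phi (v / m).
Proof.
move=> mphi iphi; have mH := @measurable_halfline R.
rewrite /Rintegral (eq_measure_integral (pushforward mu T)); last first.
  by move=> A mA _; exact: nuE.
rewrite integral_pushforward//.
- by rewrite TH.
- exact/measurable_EFinP.
- by rewrite TH.
Qed.

Lemma rescaled_moment s :
  (moment s nu = (m `^ (- s))%:E * moment s mu)%E.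
Proof.
have mH := @measurable_halfline R.
have mp : measurable_fun [set: measurableTypeR R] (fun v : R => (`|v| `^ s)%:E).
  apply/measurable_EFinP.
  by apply: (measurableT_comp (f := fun x : R => x `^ s));
    first exact: measurable_powR.
rewrite /moment (eq_measure_integral (pushforward mu T)); last first.
  by move=> A mA _; exact: nuE.
rewrite ge0_integral_pushforward//; last by apply: measurable_funTS.
rewrite TH -ge0_integralZl//; last 2 first.
- by apply: measurable_funTS.
- by rewrite lee_fin powR_ge0.
apply: eq_integral => v _; rewrite /T /= -EFinM normrM powRM//.
by rewrite mulrC gtr0_norm ?invr_gt0// -(powR_inv1 (ltW m0)) -powRrM mulN1r.
Qed.

End rescaling.

(** * Propagation of moments *)

Section truncated_gain.
Context {R : realType}.
Implicit Types (mu : proba R) (s p q eps eta M : R).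

Let H : set (measurableTypeR R) := @halfline R.

Lemma measurable_psiM s eps :
  measurable_fun [set: R] (fun v : R => psi s (eps * v)).
Proof. by apply: measurableT_comp (measurable_psi s) _; exact: measurable_funM. Qed.

Lemma psiM_bounded s eps (v : R) : 0 < s -> 0 <= eps -> 0 <= v ->
  `|psi s (eps * v)| <= s `^ s.
Proof. by move=> s0 e0 v0; rewrite ger0_norm ?psi_ge0// psi_le// mulr_ge0. Qed.

Lemma integrable_psi mu s eps : 0 < s -> 0 <= eps ->
  mu.-integrable H (EFin \o (fun v => psi s (eps * v))).
Proof.
move=> s0 e0; apply: bounded_integrable (measurable_psiM s eps) _ => v.
exact: psiM_bounded.
Qed.

(** Integrate [psiD_le] at (p eps v, q eps w) by Fubini: the linear factors become means, and the
    remainders are homogeneous of degree s in eps M, the same scaling as the supersolution. *)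
Lemma gain_psi_le mu s p q eps eta M : 1 <= s -> 0 < p -> 0 < q -> 0 < eps ->
  0 < eta -> mu (~` H) = 0%E -> mu.-integrable H (EFin \o (fun v => v)) ->
  mean mu = M -> 0 < M ->
  gain p q (fun v => psi s (eps * v)) mu <=
  (1 + s * 2 `^ s * eta) *
    ((\int[mu]_(v in H) psi s (p * eps * v)) +
     (\int[mu]_(v in H) psi s (q * eps * v))) +
  s * 2 `^ s * eta^-1 `^ (s - 1) * (p `^ s + q `^ s) * (eps * M) `^ s.
Proof.
move=> s1 p0 q0 e0 eta0 mu0 iid meanM M0.
have s0 : 0 < s by rewrite (lt_le_trans _ s1).
have mH := @measurable_halfline R; have mH2 := @measurable_halfline2 R.
have [pe0 qe0] : 0 < p * eps /\ 0 < q * eps by rewrite !mulr_gt0.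
(* Chosen so that each parameter times the mean it multiplies equals [eta], whatever [eps] is. *)
pose l := eta / (q * eps * M); pose k := eta / (p * eps * M).
have l0 : 0 < l by rewrite divr_gt0// mulr_gt0.
have k0 : 0 < k by rewrite divr_gt0// mulr_gt0.
have ip := integrable_psi mu s0 (ltW pe0).
have iq := integrable_psi mu s0 (ltW qe0).
have [ip1 Ep] := integrable_fst mu0 ip.
have [iq2 Eq] := integrable_snd mu0 iq.
have i1 : mu.-integrable H (EFin \o (fun=> 1 : R)).
  by apply: (@bounded_integrable _ _ _ 1) => // v _; rewrite normr1.
have il := integrable_linear2 l (l^-1 `^ (s - 1)) mH ip i1.
have ik := integrable_linear2 k (k^-1 `^ (s - 1)) mH iq i1.
have iqe := integrable_linear2 (q * eps) 0 mH iid iid.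
have ipe := integrable_linear2 (p * eps) 0 mH iid iid.
have iA := integrable_prodM mH mH il iqe.
have iB := integrable_prodM mH mH ipe ik.
have iAB := integrable_linear2 1 1 mH2 iA iB.
have iU := integrable_linear2 1 1 mH2 ip1 iq2.
have iall := integrable_linear2 1 (s * 2 `^ s) mH2 iU iAB.
have ig := gain_integrable mu (ltW p0) (ltW q0) (measurable_psiM s eps)
  (fun v v0 => psiM_bounded s0 (ltW e0) v0).
have := le_Rintegral mH2 ig iall.
rewrite -/(gain p q (fun v => psi s (eps * v)) mu).
rewrite (Rintegral_linear2 _ _ mH2 iU iAB) (Rintegral_linear2 _ _ mH2 iA iB).
rewrite (Rintegral_linear2 _ _ mH2 ip1 iq2) Ep Eq.
rewrite (Rintegral_prodM mH mH il iqe) (Rintegral_prodM mH mH ipe ik).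
rewrite (Rintegral_linear2 _ _ mH ip i1) (Rintegral_linear2 _ _ mH iq i1).
rewrite (Rintegral_linear2 _ _ mH iid iid) (Rintegral_linear2 _ _ mH iid iid).
rewrite (integral_halfline_cst 1 mu0) -/(mean mu) meanM.
move=> /(_ _)/le_trans; apply.
  move=> z /halfline2P[z1 z2].
  have x0 : 0 <= p * eps * z.1 by rewrite mulr_ge0// ltW.
  have y0 : 0 <= q * eps * z.2 by rewrite mulr_ge0// ltW.
  have := psiD_le s1 l0 k0 x0 y0.
  rewrite (_ : p * eps * z.1 + q * eps * z.2 = eps * (p * z.1 + q * z.2)); last by ring.
  by rewrite !mul0r !addr0 !mul1r !mulr1.
have key a : 0 < a -> (eta / a)^-1 `^ (s - 1) * a = eta^-1 `^ (s - 1) * a `^ s.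
  move=> a0; rewrite invf_div powRM ?invr_ge0 ?(ltW a0) ?(ltW eta0)//.
  by rewrite -(mulr_powRB1 (ltW a0) s0); ring.
have lE : l^-1 `^ (s - 1) * (q * eps * M) =
    eta^-1 `^ (s - 1) * (q `^ s * (eps * M) `^ s).
  rewrite /l key ?mulr_gt0// -mulrA powRM ?(ltW q0)//.
  by rewrite mulr_ge0 ?ltW.
have kE : k^-1 `^ (s - 1) * (p * eps * M) =
    eta^-1 `^ (s - 1) * (p `^ s * (eps * M) `^ s).
  rewrite /k key ?mulr_gt0// -mulrA powRM ?(ltW p0)//.
  by rewrite mulr_ge0 ?ltW.
have lq : l * (q * eps * M) = eta by rewrite /l divfK// gt_eqF// mulr_gt0.
have kp : k * (p * eps * M) = eta by rewrite /k divfK// gt_eqF// mulr_gt0.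
rewrite !mul0r !addr0 !mul1r !mulr1 le_eqVlt; apply/orP; left; apply/eqP.
set Up := Rintegral _ _ _; set Uq := Rintegral _ _ _.
rewrite [(l * Up + _) * _]mulrDl lE (mulrAC l) lq.
rewrite [(p * eps * M) * _]mulrC [(k * Uq + _) * _]mulrDl kE (mulrAC k) kp.
by ring.
Qed.

End truncated_gain.

(** * Moment bound for the unscaled solution *)

Section moment_propagation.
Context {R : realType}.
Variables (p q s : R).
Hypotheses (p0 : 0 < p) (q0 : 0 < q) (s1 : 1 < s).

Let C := s * 2 `^ s.
Let sigma := p `^ s + q `^ s.
(** This is [- calR p q (s - 1)], the dissipation rate of the moment of order s. *)
Let rate := 1 + s * (p + q - 1) - sigma.
Hypothesis rate0 : 0 < rate.
Let eta := rate / (2 * sigma * C).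

(* With this choice of eta the terms C eta sigma coming from the cross terms
   use up half of the dissipation rate. *)
Definition moment_const := 2 * sigma * C * eta^-1 `^ (s - 1) / rate.

Variables (alpha : R) (f0 : proba R) (f : R -> proba R).
Hypothesis alpha1 : 1 <= alpha.
Hypothesis ws : weak_solution p q alpha f0 f.
Hypothesis mean_f :
  forall t : R, 0 < t -> mean (f t) = expR ((p + q - 1) * t).
Hypothesis f0s : (moment s f0 < +oo)%E.

Variable Z : R.
Hypotheses (Zc : moment_const <= Z)
  (Z0 : \int[f0]_(v in halfline) v `^ s <= Z).

Let H : set (measurableTypeR R) := @halfline R.

Let s0 : 0 < s. Proof. exact: lt_trans s1. Qed.
Let C0 : 0 < C. Proof. by rewrite mulr_gt0// powR_gt0. Qed.
Let sigma0 : 0 < sigma. Proof. by rewrite addr_gt0 ?powR_gt0. Qed.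
Let eta0 : 0 < eta. Proof. by rewrite divr_gt0 ?mulr_gt0. Qed.

Lemma psi_subsolution eps : 0 < eps ->
  subsolution (fun t => \int[f t]_(v in H) psi s (eps * v))
    (fun t => gain p q (fun v => psi s (eps * v)) (f t))
    (\int[f0]_(v in H) psi s (eps * v)).
Proof.
move=> e0; apply: (weak_subsolution (ltW p0) (ltW q0) ws).
- exact: measurable_psiM.
- by exists (s `^ s) => v v0; rewrite psiM_bounded// ltW.
move=> d d0; have [h [h0 hd]] := psi_reg_approx (ltW s1) d0.
exists (fun v => psi_reg s h (eps * v)); split.
  apply: smoothb_test => n; apply: smoothb_comp_scale; first exact: ltW.
  exact: smoothb_psi_reg.
by move=> v v0; apply: hd; rewrite mulr_ge0// ltW.
Qed.

(** Comparison over all [eps] > 0 simultaneously, since the gain at [eps] calls for the integrals at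
    p eps and q eps. At time 0 the bound holds because psi is below the undamped power. *)
Lemma truncated_moment_le eps t : 0 < eps -> 0 < t ->
  \int[f t]_(v in H) psi s (eps * v) <=
  Z * (eps * expR ((p + q - 1) * t)) `^ s.
Proof.
move=> e0 t0.
have mH := @measurable_halfline R.
have Zge0 : 0 <= Z.
  by rewrite (le_trans _ Z0)// Rintegral_ge0// => v _; exact: powR_ge0.
pose I := {e : R | 0 < e}.
pose m t := expR ((p + q - 1) * t).
pose K := s * (p + q - 1).
have mE e u : 0 < e -> (e * m u) `^ s = e `^ s * expR (K * u).
  move=> e0'; rewrite powRM ?expR_ge0 ?(ltW e0')//; congr (_ * _).
  by rewrite /powR gt_eqF ?expR_gt0// expRK mulrA.
pose Y (i : I) t := Z * (val i `^ s * expR (K * t)).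
pose dY (i : I) t := Z * (val i `^ s * (K * expR (K * t))).
pose U (i : I) t := \int[f t]_(v in H) psi s (val i * v).
suff: forall (i : I) t, 0 < t -> U i t <= Y i t.
  by move=> /(_ (exist _ eps e0) t t0); rewrite /U /Y /= -mE.
have Y0 i u : 0 <= Y i u by rewrite !mulr_ge0 ?powR_ge0 ?expR_ge0.
have sub (i : I) := @psi_subsolution (val i) (valP i).
(* The a priori bound is the supremum bound s^s of psi. With this K, (K + 1)/2 exceeds the factor 2
   (1 + C eta) of the propagated error by 1/2. *)
apply: (@comparison _ I U _ Y dY _ (4 * (1 + C * eta)) (s `^ s) sub) => //.
- move=> i u; rewrite /Y /dY.
  by apply: is_derive_eq; rewrite /GRing.scale/=; ring.
- move=> [e /= e0']; rewrite /Y /= mulr0 expR0 mulr1.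
  rewrite (@le_trans _ _ (e `^ s * \int[f0]_(v in H) v `^ s))//; last first.
    by rewrite mulrC ler_wpM2r ?powR_ge0.
  have ifs : f0.-integrable H (EFin \o (fun v => v `^ s)).
    by apply: integrable_powR f0s; rewrite lexx ltW.
  rewrite -RintegralZl//; apply: le_Rintegral => //.
  + by apply: integrable_psi => //; exact: ltW.
  + by rewrite /comp; under eq_fun do rewrite EFinM; exact: integrableZl.
  + move=> v /halflineP v0; rewrite -powRM ?(ltW e0')//.
    by rewrite psi_le_powR// mulr_ge0 ?(ltW e0').
- exact: powR_ge0.
- by rewrite !mulr_ge0// addr_ge0// mulr_ge0 ?ltW.
- move=> [e /= e0'] u u0; rewrite -[leLHS]add0r lerD// /U /=.
  have fuH : f u (~` H) = 0%E by case: ws => _ /(_ u u0)[].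
  rewrite -[leRHS](integral_halfline_cst _ fuH); apply: le_Rintegral => //.
  + by apply: integrable_psi => //; exact: ltW.
  + by apply: (@bounded_integrable _ _ _ `|s `^ s|).
  + by move=> v /halflineP v0; rewrite psi_le// mulr_ge0 ?(ltW e0').
move=> S S0 HS [e /= e0'] u u0.
have [fuH fua] : in_M alpha (f u) by case: ws => _ /(_ u u0).
have := gain_psi_le (ltW s1) p0 q0 e0' eta0 fuH (integrable_id alpha1 fua)
  (mean_f u0) (expR_gt0 _).
rewrite -/(m u) mE// -/C -/sigma => /le_trans; apply.
have h1 := HS (exist _ (p * e) (mulr_gt0 p0 e0')) u u0.
have h2 := HS (exist _ (q * e) (mulr_gt0 q0 e0')) u u0.
rewrite /U /Y /= !powRM ?(ltW p0) ?(ltW q0) ?(ltW e0')// in h1 h2.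
have Ceta : 0 <= 1 + C * eta by rewrite addr_ge0// mulr_ge0 ?ltW.
apply: le_trans (lerD (ler_wpM2l Ceta (lerD h1 h2)) (lexx _)) _.
rewrite /Y /dY /=.
set E := e `^ s * expR (K * u).
have E0 : 0 <= E by rewrite mulr_ge0 ?powR_ge0 ?expR_ge0.
set X := expR (4 * (1 + C * eta) * u).
have X0 : 0 <= X by exact: expR_ge0.
have CZ : C * eta * sigma = rate / 2.
  by rewrite /eta; field; rewrite !gt_eqF.
(* The second half of the rate pays for the source term; this fixes the value of [moment_const]. *)
have Zr : C * eta^-1 `^ (s - 1) * sigma <= Z * (rate / 2).
  have := Zc; rewrite /moment_const ler_pdivrMr//; lra.
have hE := ler_wpM2r E0 Zr.
have SX : 0 <= S * X by rewrite mulr_ge0.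
rewrite -subr_ge0.
rewrite (_ : _ - _ = (Z * (rate / 2) * E - C * eta^-1 `^ (s - 1) * sigma * E) +
   (S * X) / 2 + Z * E * (rate / 2 - C * eta * sigma)).
  by rewrite CZ subrr mulr0 addr0 addr_ge0 ?subr_ge0// divr_ge0.
by rewrite /E /rate /sigma /K; field.
Qed.

(** Divide the truncated bound by eps^s: the right side no longer depends on eps, and monotone
    convergence removes the damping along eps = 1/(n + 1). *)
Lemma moment_weak_solution_le t : 0 < t ->
  (moment s (f t) <= (Z * expR (s * (p + q - 1) * t))%:E)%E.
Proof.
move=> t0; have mH := @measurable_halfline R.
pose e n : R := harmonic n.
have e0 n : 0 < e n by rewrite invr_gt0.
pose g n (v : R) := (v `^ s * expR (- (e n * v)))%:E.
have mg n : measurable_fun H (g n).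
  apply/measurable_EFinP/measurable_funTS; apply: measurable_funM.
    exact: measurable_powR.
  exact: measurable_expN.
have g0 n v : H v -> (0 <= g n v)%E.
  by move=> _; rewrite lee_fin mulr_ge0 ?powR_ge0 ?expR_ge0.
have gnd v : H v -> {homo g^~ v : n k / (n <= k)%N >-> (n <= k)%E}.
  move=> /halflineP v0 n k nk; rewrite lee_fin ler_wpM2l ?powR_ge0// ler_expR.
  by rewrite lerN2 ler_wpM2r// /e /= lef_pV2 ?posrE// ler_nat.
have ecvg v : expR (- (e n * v)) @[n --> \oo] --> (1 : R).
  exact: cvg_expN_harmonic.
have -> : moment s (f t) = (\int[f t]_(v in H) limn (g ^~ v))%E.
  apply: eq_integral => v; rewrite inE => /halflineP v0; rewrite ger0_norm//.
  apply/esym/cvg_lim => //.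
  apply: cvg_EFin; first exact: nearW.
  by rewrite -[X in _ --> X]mulr1; exact: cvgMr.
rewrite monotone_convergence//; apply: lime_le.
  by apply: (cvgP _ (cvg_monotone_convergence mH mg g0 gnd)).
apply: nearW => n.
have ep : 0 < e n `^ s by rewrite powR_gt0.
have ig : (f t).-integrable H
    (EFin \o (fun v : R => v `^ s * expR (- (e n * v)))).
  have ip := integrable_psi (f t) s0 (ltW (e0 n)).
  apply: eq_integrable (integrable_linear2 (e n `^ s)^-1 0 mH ip ip) => //.
  move=> v; rewrite inE => /halflineP v0 /=.
  by rewrite mul0r addr0 /psi powRM ?(ltW (e0 n))// -mulrA mulKf// gt_eqF.
have ftn : \int[f t]_(v in H) psi s (e n * v) =
    e n `^ s * \int[f t]_(v in H) (v `^ s * expR (- (e n * v))).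
  rewrite -RintegralZl//; apply: eq_Rintegral => v; rewrite inE => /halflineP v0.
  by rewrite /psi powRM ?(ltW (e0 n))// mulrA.
have := truncated_moment_le (e0 n) t0.
rewrite ftn powRM ?expR_ge0 ?(ltW (e0 n))// mulrCA ler_pM2l//.
rewrite (_ : expR _ `^ s = expR (s * (p + q - 1) * t)); last first.
  by rewrite /powR gt_eqF ?expR_gt0// expRK mulrA.
by rewrite -lee_fin /Rintegral fineK//; exact: integrable_fin_num.
Qed.

End moment_propagation.

(** * Large-time behaviour *)

(** Convexity in the exponent together with [calR p q 0] = 0. Negativity at delta is thereby
    inherited by all smaller positive exponents. *)
Lemma calR_convex {R : realType} (p q delta theta : R) :
  0 < p -> 0 < q -> 0 <= theta <= 1 ->
  calR p q (theta * delta) <= theta * calR p q delta.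
Proof.
move=> p0 q0 th.
have key (x : R) : 0 < x -> x `^ (1 + theta * delta) <=
    (1 - theta) * x + theta * x `^ (1 + delta).
  move=> x0; have xn : x != 0 by rewrite gt_eqF.
  have h := powR_le_chord th (powR_gt0 delta x0).
  rewrite !powRD ?xn ?implybT// !powRr1 ?(ltW x0)// (mulrC theta delta) powRrM.
  rewrite [leRHS](_ : _ = x * (1 - theta + theta * x `^ delta)); last by ring.
  by rewrite ler_pM2l.
have := key _ p0; have := key _ q0; rewrite /calR; lra.
Qed.

Section asymptotics.
Context {R : realType}.
Variables (p q alpha : R) (f0 ginf : proba R) (f g : R -> proba R).
Hypotheses (p0 : 0 < p) (q0 : 0 < q) (alpha1 : 1 < alpha).
Hypothesis ws : weak_solution p q alpha f0 f.
Hypothesis st : stationary_solution p q alpha ginf.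
Hypothesis mean0 : mean f0 = 1.
Hypothesis gE : forall t, 0 < t ->
  forall A : set (measurableTypeR R), measurable A ->
    g t A = pushforward (f t) (fun v : measurableTypeR R =>
              (v / mean (f t) : measurableTypeR R)) A.
Implicit Types (a b xi t r s D delta : R).

Let H : set (measurableTypeR R) := @halfline R.

Let m t := expR ((p + q - 1) * t).

Let mean_f t : 0 < t -> mean (f t) = m t.
Proof. exact: (mean_weak_solution (ltW p0) (ltW q0) alpha1 ws st mean0). Qed.

Let m0 t : 0 < m t. Proof. exact: expR_gt0. Qed.

Let gE' t : 0 < t -> forall A : set (measurableTypeR R), measurable A ->
  g t A = pushforward (f t) (fun v : measurableTypeR R =>
              (v / m t : measurableTypeR R)) A.
Proof. by move=> t0 A mA; rewrite gE// mean_f. Qed.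

Let f0H : f0 (~` H) = 0%E. Proof. by case: ws => -[]. Qed.
Let ginfH : ginf (~` H) = 0%E. Proof. by case: st => -[]. Qed.
Let fM t : 0 < t -> in_M alpha (f t).
Proof. by move=> t0; case: ws => _ /(_ t t0). Qed.

Lemma scaled_halfline t : 0 < t -> g t (~` H) = 0%E.
Proof.
move=> t0; apply: (rescaled_halfline (m0 t) (gE' t0)).
by have [] := fM t0.
Qed.

Lemma scaled_mean t : 0 < t -> mean (g t) = 1.
Proof.
move=> t0; have [_ fa] := fM t0.
have iid := integrable_id (ltW alpha1) fa.
have mH := @measurable_halfline R.
rewrite /mean (rescaled_Rintegral (m0 t) (gE' t0) (phi := fun v => v))//; last first.
  apply: eq_integrable (integrable_linear2 (m t)^-1 0 mH iid iid) => // v _.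
  by rewrite /= mul0r addr0 mulrC.
by rewrite RintegralZr// -/(mean (f t)) mean_f// mulfV// gt_eqF.
Qed.

Lemma scaled_trig t a b xi : 0 < t ->
  \int[g t]_(v in H) trig a b (xi * v) =
  \int[f t]_(v in H) trig a b (xi / m t * v).
Proof.
move=> t0; have E v : trig a b (xi * (v / m t)) = trig a b (xi / m t * v).
  by congr trig; ring.
rewrite (rescaled_Rintegral (m0 t) (gE' t0) (measurable_trig a b xi)).
  by apply: eq_Rintegral => v _; exact: E.
rewrite (_ : _ \o _ = EFin \o (fun v => trig a b (xi / m t * v))).
  exact: integrable_trig.
by apply/funext => v /=; rewrite E.
Qed.

(* The rescaling turns the growth exponent p^r + q^r - 1 of the unscaled
   problem into p^r + q^r - 1 - r(p + q - 1). *)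
Lemma scaled_trig_contraction r D : 0 <= D ->
  (forall a b xi, a ^+ 2 + b ^+ 2 <= 1 ->
     \int[f0]_(v in H) trig a b (xi * v) - \int[ginf]_(v in H) trig a b (xi * v)
       <= D * `|xi| `^ r) ->
  forall a b xi t, a ^+ 2 + b ^+ 2 <= 1 -> 0 < t ->
    \int[g t]_(v in H) trig a b (xi * v) - \int[ginf]_(v in H) trig a b (xi * v)
      <= D * `|xi| `^ r * expR ((p `^ r + q `^ r - 1 - r * (p + q - 1)) * t).
Proof.
move=> D0 init a b xi t ab t0.
have := trig_diff_le (ltW p0) (ltW q0) alpha1 ws st D0 init (xi / m t) ab t0.
rewrite /trig_diff -scaled_trig//.
rewrite (_ : expR _ * (xi / m t) = xi); last by rewrite -/(m t) mulrC divfK// gt_eqF.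
move=> /le_trans; apply; rewrite normf_div (gtr0_norm (m0 t)).
rewrite -!mulrA ler_wpM2l// powRM// ?invr_ge0 ?(ltW (m0 t))//.
rewrite -mulrA ler_wpM2l ?powR_ge0//.
rewrite /powR gt_eqF ?invr_gt0// lnV ?posrE// expRK -expRD.
by rewrite le_eqVlt; apply/orP; left; apply/eqP; congr expR; ring.
Qed.

(** Rescaling by the mean divides the moment of order s by m(t)^s, exactly the growth allowed for
    the unscaled solution. *)
Lemma scaled_moment_le delta t : 0 < delta -> calR p q delta < 0 ->
  (moment (1 + delta) f0 < +oo)%E -> 0 < t ->
  (moment (1 + delta) (g t) <=
     maxe (moment_const p q (1 + delta))%:E (moment (1 + delta) f0))%E.
Proof.
move=> d0 hR ms t0; set s := 1 + delta in ms *.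
have s1 : 1 < s by rewrite ltrDl.
have rate0 : 0 < 1 + s * (p + q - 1) - (p `^ s + q `^ s).
  by move: hR; rewrite /calR -/s; lra.
have s0 : 0 <= s by rewrite (le_trans ler01 (ltW s1)).
rewrite (moment_Rintegral s0 ms) -EFin_max.
set Z := Num.max _ _.
have Zc : moment_const p q s <= Z by rewrite le_max lexx.
have Z0 : \int[f0]_(v in H) v `^ s <= Z by rewrite le_max lexx orbT.
have := moment_weak_solution_le p0 q0 s1 rate0 (ltW alpha1) ws mean_f ms Zc Z0 t0.
rewrite (rescaled_moment (m0 t) (gE' t0)).
have ms0 : 0 < m t `^ (- s) by rewrite powR_gt0.
move=> /(lee_wpmul2l (x := (m t `^ (- s))%:E)) => /(_ _)/le_trans; apply.
  by rewrite lee_fin ltW.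
rewrite -EFinM lee_fin mulrCA (_ : _ * expR _ = 1) ?mulr1//.
rewrite /powR gt_eqF// expRK -expRD -[RHS]expR0; congr expR; ring.
Qed.

Lemma scaled_fourier_dist_le delta t : 0 < t -> calR p q delta < 0 ->
  (fourier_dist (1 + delta) (g t) ginf <=
     fourier_dist (1 + delta) f0 ginf * (expR (- (`|calR p q delta| * t)))%:E)%E.
Proof.
move=> t0 hR; have := fourier_dist_ge0 (1 + delta) f0 ginf.
(* If the initial distance is infinite, so is the right side, because the exponential is
   positive. *)
case E : (fourier_dist (1 + delta) f0 ginf) => [D| |] // D0; last first.
  by rewrite gt0_mulye ?leey// lte_fin expR_gt0.
rewrite lee_fin in D0; rewrite -EFinM.
apply: fourier_dist_le.
- exact: scaled_halfline.
- exact: ginfH.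
- by rewrite mulr_ge0 ?expR_ge0.
move=> a b xi ab _; rewrite mulrAC.
have init := @trig_diff_le_fourier_dist _ f0 ginf (1 + delta) D f0H ginfH D0.
rewrite E lexx in init.
rewrite (le_trans (scaled_trig_contraction D0 (init isT) xi ab t0))//.
rewrite ler_wpM2l ?mulr_ge0 ?powR_ge0// ler_expR ltr0_norm// /calR.
by rewrite mulNr opprK.
Qed.

Lemma fourier_dist_initial_finite delta : 0 < delta <= 1 -> calR p q delta < 0 ->
  (moment (1 + delta) f0 < +oo)%E -> (fourier_dist (1 + delta) f0 ginf < +oo)%E.
Proof.
move=> /andP[d0 d1] hR ms.
set s := 1 + delta in ms *.
have s1 : 1 < s by rewrite ltrDl.
have s2 : s <= 2 by rewrite /s; lra.
have s0 : 0 <= s by rewrite (le_trans ler01 (ltW s1)).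
pose r := Num.min alpha s.
have r1 : 1 < r by rewrite lt_min alpha1.
have rs : r <= s by rewrite ge_min lexx orbT.
have ra : r <= alpha by rewrite ge_min lexx.
have r0 : 0 <= r by rewrite (le_trans ler01 (ltW r1)).
have r12 : 1 <= r <= 2 by rewrite (ltW r1) (le_trans rs).
have s12 : 1 <= s <= 2 by rewrite (ltW s1).
have rs' : 0 <= r <= s by rewrite r0.
have ra' : 0 <= r <= alpha by rewrite r0.
pose rho := p `^ r + q `^ r - 1 - r * (p + q - 1).
(* The exponent r - 1 is a fraction theta of delta, so convexity of [calR] applies. *)
have rho0 : rho < 0.
  pose theta := (r - 1) / delta.
  have th0 : 0 < theta by rewrite divr_gt0// subr_gt0.
  have th1 : theta <= 1 by rewrite /theta ler_pdivrMr// mul1r lerBlDl.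
  have := @calR_convex _ p q delta theta p0 q0.
  rewrite (ltW th0) th1 => /(_ isT) h.
  have : calR p q (theta * delta) < 0.
    by rewrite (le_lt_trans h)// pmulr_rlt0.
  by rewrite /theta divfK ?gt_eqF// /calR addrCA subrr addr0.
have ms_r := moment_lty rs' ms.
have mg_r : (moment r ginf < +oo)%E.
  by apply: (moment_lty ra'); case: st => -[].
have meang : mean ginf = 1 by case: st.
set D := 4 * (\int[f0]_(v in H) v `^ r + \int[ginf]_(v in H) v `^ r).
have D0 : 0 <= D.
  by rewrite mulr_ge0// addr_ge0// Rintegral_ge0// => v _; exact: powR_ge0.
have init : forall a b xi, a ^+ 2 + b ^+ 2 <= 1 ->
     \int[f0]_(v in H) trig a b (xi * v) -
     \int[ginf]_(v in H) trig a b (xi * v) <= D * `|xi| `^ r.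
  by apply: trig_int_diff_le => //; rewrite mean0.
pose Z := Num.max (moment_const p q s) (\int[f0]_(v in H) v `^ s).
have g_s t : 0 < t -> (moment s (g t) <= Z%:E)%E.
  by move=> t0; rewrite EFin_max -moment_Rintegral//; exact: scaled_moment_le.
have B0 : 0 <= 4 * (\int[f0]_(v in H) v `^ s + Z).
  rewrite mulr_ge0// addr_ge0 ?le_max// Rintegral_ge0 ?orbT// => v _;
  exact: powR_ge0.
apply: (@le_lt_trans _ _ (4 * (\int[f0]_(v in H) v `^ s + Z))%:E); last exact: ltry.
apply: fourier_dist_le => // a b xi ab _.
apply/ler_addgt0Pr => e e0.
pose A := D * `|xi| `^ r.
have A0 : 0 <= A by rewrite mulr_ge0 ?powR_ge0.
(* A time so large that A exp(rho t) <= e, by exp(x) >= 1 + x at x = A/e + 1. *)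
pose t := (A / e + 1) / - rho.
have t0 : 0 < t by rewrite divr_gt0 ?oppr_gt0// ltr_wpDl// divr_ge0// ltW.
have := scaled_trig_contraction D0 init xi ab t0; rewrite -/rho -/A.
have small : A * expR (rho * t) <= e.
  rewrite (_ : rho * t = - (A / e + 1)); last first.
    by rewrite /t; field; rewrite gt_eqF// lt_eqF.
  rewrite expRN ler_pdivrMr ?expR_gt0// mulrC -ler_pdivrMr//.
  by rewrite (le_trans _ (expR_ge1Dx _))// addrCA lerDl.
have gts := le_lt_trans (g_s t t0) (ltry _).
(* Split the difference at g(t): the part from f0 to g(t) has order s uniformly in t, and the part
   from g(t) to the steady state is at most e. *)
have := trig_int_diff_le f0H (scaled_halfline t0) s12 ms gts _ xi ab.
rewrite mean0 scaled_mean// => /(_ erefl).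
have := g_s t t0; rewrite moment_Rintegral// lee_fin => hZ.
have := powR_ge0 `|xi| s; nra.
Qed.

End asymptotics.

(** The initial moment enters the first bound because near time 0 the solution is close to [f0],
    whose moment can be arbitrarily large. For delta > 1 the order exceeds 2, and equal means alone
    do not make the initial distance finite; hence the alternative before the convergence claim. *)
Theorem theorem3p12 (R : realType) (p q delta : R)
    (hq : 0 < q) (hpq : q < p) (hdelta : 0 < delta)
    (hR : calR p q delta < 0) :
  exists c : R,
    forall (alpha : R) (f0 ginf : proba R) (g : R -> proba R),
      1 < alpha ->
      stationary_solution p q alpha ginf ->
      mean f0 = 1 ->
      (moment (1 + delta) f0 < +oo)%E ->
      scaled_solution p q alpha f0 g ->
      [/\ forall t : R, 0 < t ->
            (moment (1 + delta) (g t) <=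
               maxe c%:E (moment (1 + delta) f0))%E,
          delta <= 1 \/ (fourier_dist (1 + delta) f0 ginf < +oo)%E ->
            exp_convergence (1 + delta) g ginf &
          forall t : R, 0 < t ->
            (fourier_dist (1 + delta) (g t) ginf <=
               fourier_dist (1 + delta) f0 ginf *
               (expR (- (`|calR p q delta| * t)))%:E)%E].
Proof.
have hp : 0 < p := lt_trans hq hpq.
exists (moment_const p q (1 + delta)).
move=> alpha f0 ginf g alpha1 st mean0 ms [f ws gE].
have decay (t : R) (t0 : 0 < t) :=
  scaled_fourier_dist_le hp hq alpha1 ws st mean0 gE t0 hR.
split.
- by move=> t t0; exact: (scaled_moment_le hp hq alpha1 ws st mean0 gE).
- move=> fin.
  have {fin} : (fourier_dist (1 + delta) f0 ginf < +oo)%E.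
    case: fin => // d1.
    by apply: (fourier_dist_initial_finite hp hq alpha1 ws st mean0 gE) => //;
      rewrite hdelta.
  have := fourier_dist_ge0 (1 + delta) f0 ginf.
  case E : (fourier_dist (1 + delta) f0 ginf) => [D| |] // _ _.
  exists D, `|calR p q delta|; split; first by rewrite normr_gt0 lt_eqF.
  by move=> t t0; rewrite EFinM -E; exact: decay.
- exact: decay.
Qed.
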